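(* Let $\mathbf{A}\in\mathbb{R}^{n\times n}$ be symmetric and let $P$ processors be arranged in a $\sqrt{P/c}\times\sqrt{P/c}\times c$ grid with $1\le c\le P^{1/3}$. Suppose 2.5D parallel Jacobi (the algorithm described in the context) is run with batching parameter $\mu=\Theta(\sqrt{P/c^3})$ (subject to the requirement $c\le\mu\le\sqrt{P/c}$) and utilization factor $\eta=1$, meaning all available processors are utilized in each call to 2D parallel Jacobi, and assume that only $O(1)$ sweeps of the 2D algorithm are applied to each subproblem. Then the complexity of each sweep is $$\alpha\cdot O\!\left(\sqrt{cP}\,\log\!\left(\frac{P}{c}\right)\right)+\beta\cdot O\!\left(\frac{n^2}{\sqrt{cP}}\right)+\gamma\cdot O\!\left(\frac{n^3}{P}\right).$$
   Context: **Cost model.** For a parallel algorithm on $P$ distributed-memory processors, $S$ is the number of messages sent along the critical path (longest chain of serially dependent operations), $W$ the maximum number of words communicated by any processor along it, $F$ the maximum number of flops performed by any processor along it; the cost is $\alpha S+\beta W+\gamma F$, with $\alpha,\beta,\gamma$ the times per message, word and flop. ''Complexity $\alpha\cdot O(f)+\beta\cdot O(g)+\gamma\cdot O(h)$'' means $S=O(f)$, $W=O(g)$, $F=O(h)$. Communication and computation do not overlap on a processor; there is no contention. Sending $w$ words point-to-point costs $O(1)$ messages and $O(w)$ words. Collectives involving $p$ processors and $w\ge p$ words cost: scatter or gather $\alpha\log_2p+\beta w$; broadcast $2\alpha\log_2p+2\beta w$; reduce $2\alpha\log_2p+2\beta w+\gamma w$. Local $k\times k$ matrix multiplication and symmetric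 diagonalization cost $O(k^3)$ flops. All quantities that need to be integers (grid dimensions, block sizes, numbers of groups) are assumed to be integers. **Subroutine: 2.5D matrix multiplication.** It multiplies two $N\times N$ matrices, initially block-distributed on the top layer of a $\sqrt{p/c}\times\sqrt{p/c}\times c$ grid of $p$ processors ($1\le c\le p^{1/3}$), by replicating the inputs to all $c$ layers, letting each layer carry out a $1/c$ fraction of the steps of Cannon's algorithm, and sum-reducing to the top layer. Its known complexity (Solomonik–Demmel) is $\alpha\cdot O(\sqrt{p/c^3}+\log c)+\beta\cdot O(N^2/\sqrt{cp})+\gamma\cdot O(N^3/p)$. **Index list.** For an integer $q$, the anti-diagonal list on $q$ indices consists of $q$ groups; for $K=0,\dots,q-1$ the group consists of all pairs $(I,J)$, $1\le I<J\le q$, with $I+J\equiv K\pmod q$. Pairs within a group are disjoint. **Subroutine: one sweep of 2D parallel Jacobi** on a symmetric $N\times N$ matrix $\mathbf{M}$ and orthogonal $\mathbf{Q}$, both distributed in $\hat b\times\hat b$ blocks, $\hat b=N/\sqrt p$, on a $\sqrt p\times\sqrt p$ grid (one block of each per processor $(I,J)$). Groups of the anti-diagonal list on $\sqrt p$ indices are processed serially; for each group all pairs $(I,J)$ are processed in parallel: processors $(I,I)$ and $(J,J)$ send their diagonal blocks to $(I,J)$, which locally diagonalizes the $2\hat b\times2\hat b$ matrix $\mathbf{M}([I,J],[I,J])=\mathbf{V}\mathbf{D}\mathbf{V}^T$ and sends the needed $\hat b\times\hat b$ blocks of $\mathbf{V},\mathbf{D}$ to $(I,I),(J,J),(J,I)$;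 $\mathbf{M}([I,J],[I,J])$ is overwritten by $\mathbf{D}$; processors in block rows $I,J$ (and block columns $I,J$) pairwise exchange their blocks of $\mathbf{M}$ (and of $\mathbf{Q}$, for columns); $(I,I)$ and $(J,J)$ each broadcast two $\hat b\times\hat b$ blocks of $\mathbf{V}$ along their row and column; then each processor in block rows/columns $I,J$ updates its blocks locally, so that block rows $I,J$ of $\mathbf{M}$ are multiplied on the left by $\mathbf{V}^T$, and block columns $I,J$ of $\mathbf{M}$ and $\mathbf{Q}$ on the right by $\mathbf{V}$. **2.5D layout.** Processors are $\mathrm{Proc}\langle p,q,r\rangle$, $1\le p,q\le\sqrt{P/c}$, $1\le r\le c$; $r=1$ is the top layer. Let $b=n/\sqrt{P/c}$ and $B=\mu b$, where $c\le\mu\le\sqrt{P/c}$ is the batching parameter. On the top layer, each processor owns one $b\times b$ block (fine tile) of $\mathbf{A}$ and of the accumulated orthogonal matrix $\mathbf{Q}\in\mathbb{R}^{n\times n}$. For $1\le I,J\le n/B=\sqrt{P/c}/\mu$, the coarse tile $\mathbf{A}_{IJ}=\mathbf{A}((I-1)B+1:IB,(J-1)B+1:JB)$ (likewise $\mathbf{Q}_{IJ}$) is distributed over $\mathrm{ProcTile}(I,J,1)$, where $\mathrm{ProcTile}(I,J,k)=\{\mathrm{Proc}\langle p,q,k\rangle:(I-1)\mu+1\le p\le I\mu,\ (J-1)\mu+1\le q\le J\mu\}$. $\mathrm{ProcSlab}(\cdot,\cdot,\cdot)$ denotes the union of the tiles whose indices lie in the given lists ('':'' meaning all). Sends, exchanges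 and broadcasts between coarse processor tiles are performed between individual processors occupying the same position within each tile. **One sweep of 2.5D parallel Jacobi** with utilization factor $\eta\in[2\mu/\sqrt{cP},1]$. The groups $g$ of the anti-diagonal list on $\sqrt{P/c}/\mu$ indices are processed serially; for each $g$, all $(I,J)\in g$ are processed in parallel: 1. The $2B\times2B$ subproblem $\hat{\mathbf{A}}=\mathbf{A}([I,J],[I,J])$ is scattered from $\mathrm{ProcSlab}([I,J],[I,J],1)$ ($4\mu^2$ processors) to a set $\hat{\mathfrak{P}}$ of $2\eta\mu\sqrt{cP}$ processors of $\mathrm{ProcSlab}(:,[I,J],:)$ (an $\eta$ fraction of that slab), rearranged as a square 2D grid; each sending processor scatters its $b\times b$ block to $O(\eta\sqrt{cP}/\mu)$ processors. $\hat{\mathbf{V}}$ is initialized to the $2B\times 2B$ identity over $\hat{\mathfrak{P}}$. 2. Sweeps of 2D parallel Jacobi are applied to $(\hat{\mathbf{A}},\hat{\mathbf{V}})$ over $\hat{\mathfrak{P}}$ until convergence or a maximum number of sweeps. 3. $\hat{\mathbf{A}},\hat{\mathbf{V}}$ are gathered back to $\mathrm{ProcSlab}([I,J],[I,J],1)$ (reverse of step 1) and $\mathbf{A}([I,J],[I,J])$ is overwritten by $\hat{\mathbf{A}}$. Partition $\hat{\mathbf{V}}=(\hat{\mathbf{V}}_{ij})_{i,j\in\{1,2\}}$ into $B\times B$ blocks. 4. $\mathrm{ProcTile}(J,I,1)$ sends $\hat{\mathbf{V}}_{21}$ to $\mathrm{ProcTile}(I,I,1)$; $\mathrm{ProcTile}(I,J,1)$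 sends $\hat{\mathbf{V}}_{12}$ to $\mathrm{ProcTile}(J,J,1)$. 5. For all $K$ in parallel on the top layer: exchange $\mathbf{A}_{IK}\leftrightarrow\mathbf{A}_{JK}$ and $\mathbf{A}_{KI}\leftrightarrow\mathbf{A}_{KJ}$ (if $K\ne I,J$) and $\mathbf{Q}_{KI}\leftrightarrow\mathbf{Q}_{KJ}$ between the owning tiles. 6. $\mathrm{ProcTile}(I,I,1)$ broadcasts $\hat{\mathbf{V}}_{11},\hat{\mathbf{V}}_{21}$ to all other top-layer tiles in coarse row $I$ and coarse column $I$; $\mathrm{ProcTile}(J,J,1)$ broadcasts $\hat{\mathbf{V}}_{12},\hat{\mathbf{V}}_{22}$ to those in coarse row $J$ and column $J$. 7. For all $K$ in parallel, the coarse tiles are updated: for $K\ne I,J$, $\mathbf{A}_{IK}\leftarrow\hat{\mathbf{V}}_{11}^T\mathbf{A}_{IK}+\hat{\mathbf{V}}_{21}^T\mathbf{A}_{JK}$, $\mathbf{A}_{JK}\leftarrow\hat{\mathbf{V}}_{12}^T\mathbf{A}_{IK}+\hat{\mathbf{V}}_{22}^T\mathbf{A}_{JK}$, $\mathbf{A}_{KI}\leftarrow\mathbf{A}_{KI}\hat{\mathbf{V}}_{11}+\mathbf{A}_{KJ}\hat{\mathbf{V}}_{21}$, $\mathbf{A}_{KJ}\leftarrow\mathbf{A}_{KI}\hat{\mathbf{V}}_{12}+\mathbf{A}_{KJ}\hat{\mathbf{V}}_{22}$, and for all $K$, $\mathbf{Q}_{KI}\leftarrow\mathbf{Q}_{KI}\hat{\mathbf{V}}_{11}+\mathbf{Q}_{KJ}\hat{\mathbf{V}}_{21}$,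 $\mathbf{Q}_{KJ}\leftarrow\mathbf{Q}_{KI}\hat{\mathbf{V}}_{12}+\mathbf{Q}_{KJ}\hat{\mathbf{V}}_{22}$. Each $B\times B$ product for the tile with coarse index $(R,T)$ is computed by 2.5D matrix multiplication over the $\mu\times\mu\times c$ grid $\mathrm{ProcSlab}(R,T,:)$; transposes of tiles are formed by swapping fine blocks within the tile. *)

(* Defs.v *)
(* [R : realType] serves both for the matrix entries and for the costs.  All indices (processors, tiles, groups) are 0-based. *)
From HB Require Import structures.
From mathcomp Require Import all_boot all_order all_algebra.
From mathcomp Require Import all_classical all_reals all_analysis.

Set Implicit Arguments.
Unset Strict Implicit.
Unset Printing Implicit Defensive.

Import Order.TTheory GRing.Theory Num.Theory.
Local Open Scope ring_scope.

Definition log2 {R : realType} (x : R) : R := ln x / ln 2.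

(** * Cost model *)

Record cost (R : Type) := Cost { msgs : R; words : R; flops : R }.

(* A parallel task: the processors taking part in it, and the messages, words
   and flops along its critical path, each maximised separately. *)
Record task (R : Type) (T : finType) := Task { who : {set T}; tcost : cost R }.
Arguments Task {R T}.

Section Composition.
Context {R : realType} {T : finType}.
Implicit Types l : seq (task R T).

Definition participants l : {set T} := (\bigcup_(x <- l) who x)%SET.

Definition serial l : task R T :=
  Task (participants l)
    (Cost (\sum_(x <- l) msgs (tcost x)) (\sum_(x <- l) words (tcost x))
          (\sum_(x <- l) flops (tcost x))).

(* Independent tasks run in parallel, except that the tasks sharing a processor
   are serialised on it (communication and computation do not overlap on a
   processor).  For tasks with disjoint participants this is the maximum of
   their costs. *)
Definition par_with (f : cost R -> R) l : R :=
  \big[Num.max/0]_(p : T) \sum_(x <- l | p \in who x) f (tcost x).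

Definition par l : task R T :=
  Task (participants l)
    (Cost (par_with (@msgs R) l) (par_with (@words R) l)
          (par_with (@flops R) l)).

End Composition.

(* The primitives whose cost is known only up to a constant factor; [mm25 N p c]
   is 2.5D multiplication of N x N matrices on p processors in c layers. *)
Record machine (R : Type) := Machine {
  send_msgs : nat -> R;
  send_words : nat -> R;
  matmul_flops : nat -> R;
  diag_flops : nat -> R;
  mm25 : nat -> nat -> nat -> cost R }.

Record machine_bounds (R : realType) (kappa : R) (M : machine R) : Prop := {
  send_msgsP : forall w, 0 <= send_msgs M w <= kappa;
  send_wordsP : forall w, 0 <= send_words M w <= kappa * w%:R;
  matmul_flopsP : forall k, 0 <= matmul_flops M k <= kappa * k%:R ^+ 3;
  diag_flopsP : forall k, 0 <= diag_flops M k <= kappa * k%:R ^+ 3;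
  mm25P : forall N p c g : nat, (1 <= c)%N ->
    c%:R <= p%:R `^ (3%:R^-1) :> R ->
    Num.sqrt (p%:R / c%:R) = g%:R :> R -> (g %| N)%N ->
    [/\ 0 <= msgs (mm25 M N p c)
          <= kappa * (Num.sqrt (p%:R / c%:R ^+ 3) + log2 c%:R),
        0 <= words (mm25 M N p c)
          <= kappa * (N%:R ^+ 2 / Num.sqrt (c%:R * p%:R))
      & 0 <= flops (mm25 M N p c) <= kappa * (N%:R ^+ 3 / p%:R)] }.

Section Primitives.
Context {R : realType} {T : finType} (M : machine R).

Definition send (a b : T) (w : nat) : task R T :=
  Task [set a; b]%SET (Cost (send_msgs M w) (send_words M w) 0).

Definition exchange (a b : T) (w : nat) : task R T :=
  serial [:: send a b w; send b a w].

(* [X] is the set of all processors of the collective, [w] the total number of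
   words at the root.  The formulas, established for #|X| <= w, are charged
   whatever [w] is. *)
Definition scatter (X : {set T}) (w : nat) : task R T :=
  Task X (Cost (log2 #|X|%:R) w%:R 0).

Definition gather (X : {set T}) (w : nat) : task R T :=
  Task X (Cost (log2 #|X|%:R) w%:R 0).

Definition bcast (X : {set T}) (w : nat) : task R T :=
  Task X (Cost (2%:R * log2 #|X|%:R) (2%:R * w%:R) 0).

Definition local (a : T) (f : R) : task R T := Task [set a]%SET (Cost 0 0 f).

Definition mm25_task (X : {set T}) (N c : nat) : task R T :=
  Task X (mm25 M N #|X| c).

End Primitives.

(** * Anti-diagonal list *)

(* [.+1] converts to the 1-based indices for which I + J = K (mod q) is meant. *)
Definition antidiag (q K : nat) : seq ('I_q * 'I_q) :=
  [seq p : 'I_q * 'I_q <- enum {: 'I_q * 'I_q} |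
    (p.1 < p.2)%N && (p.1.+1 + p.2.+1 == K %[mod q])%N].

(** * The matrices: block Jacobi sweeps *)

Section Jacobi.
Context {R : realType}.

(* Entries addressed by naturals, 0 outside the matrix: this avoids casts
   between the several block structures put on one matrix. *)
Definition ent m n (A : 'M[R]_(m, n)) (i j : nat) : R :=
  match insub i, insub j with
  | Some i', Some j' => A i' j'
  | _, _ => 0
  end.

Section Blocks.
Variables (N bs q : nat).

Definition in_pair (p : 'I_q * 'I_q) (i : nat) : bool :=
  (i %/ bs == p.1)%N || (i %/ bs == p.2)%N.

(* Mutually inverse index maps between the rows of the blocks I, J of an N x N
   matrix and {0, .., 2 bs - 1}. *)
Definition loc (p : 'I_q * 'I_q) (i : nat) : nat :=
  ((i %/ bs == p.2) * bs + i %% bs)%N.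
Definition unloc (p : 'I_q * 'I_q) (k : nat) : nat :=
  ((if k < bs then p.1 else p.2) * bs + k %% bs)%N.

(* A([I,J],[I,J]) *)
Definition subproblem (p : 'I_q * 'I_q) (A : 'M[R]_N) : 'M[R]_(2 * bs) :=
  \matrix_(i, j) ent A (unloc p i) (unloc p j).

Definition embed (p : 'I_q * 'I_q) (V : 'M[R]_(2 * bs)) : 'M[R]_N :=
  \matrix_(i, j) if in_pair p i && in_pair p j
                 then ent V (loc p i) (loc p j) else (i == j)%:R.

(* Given (V, D) for the pair p: A([I,J],[I,J]) is overwritten by D, the other
   entries of the block rows (columns) I, J are multiplied by V^T (by V). *)
Definition rotate (p : 'I_q * 'I_q) (VD : 'M[R]_(2 * bs) * 'M[R]_(2 * bs))
    (AQ : 'M[R]_N * 'M[R]_N) : 'M[R]_N * 'M[R]_N :=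
  let E := embed p VD.1 in
  (\matrix_(i, j) if in_pair p i && in_pair p j
                  then ent VD.2 (loc p i) (loc p j)
                  else (E^T *m AQ.1 *m E) i j,
   AQ.2 *m E).

Variable solve : 'M[R]_(2 * bs) -> 'M[R]_(2 * bs) * 'M[R]_(2 * bs).

(* All subproblems are read from the state before the group; the rotations of
   the (disjoint) pairs of a group commute. *)
Definition jacobi_group (AQ : 'M[R]_N * 'M[R]_N) (K : nat) :=
  foldl (fun st p => rotate p (solve (subproblem p AQ.1)) st) AQ (antidiag q K).

(* The state after the first K groups of a sweep. *)
Definition jacobi_groups (AQ : 'M[R]_N * 'M[R]_N) (K : nat) :=
  foldl jacobi_group AQ (iota 0 K).

Definition jacobi_sweep (AQ : 'M[R]_N * 'M[R]_N) := jacobi_groups AQ q.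

End Blocks.

(* [eig M = (V, D)] is the local symmetric diagonalisation. *)
Definition eig_spec (eig : forall k, 'M[R]_k -> 'M[R]_k * 'M[R]_k) : Prop :=
  forall k (M : 'M[R]_k), M^T = M ->
    [/\ (eig k M).1 *m (eig k M).1^T = 1%:M, is_diag_mx (eig k M).2
      & M = (eig k M).1 *m (eig k M).2 *m (eig k M).1^T].

End Jacobi.

(** * Layout *)

(* n = order of the matrix, c = layers, mu = batching parameter,
   d = sqrt(P/c), b = n/d, q = number of coarse tiles per dimension,
   s = side of the square grid on which a subproblem is solved,
   bh = block size on that grid. *)
Record layout := Layout { n_ : nat; c_ : nat; mu_ : nat; d_ : nat; b_ : nat;
                          q_ : nat; s_ : nat; bh_ : nat }.

Definition B_ (L : layout) : nat := (mu_ L * b_ L)%N.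

Record admissible (R : realType) (P : nat) (eta : R) (L : layout) : Prop := {
  adm_n : (0 < n_ L)%N;
  adm_c1 : (1 <= c_ L)%N;
  adm_cP : (c_ L)%:R <= P%:R `^ (3%:R^-1) :> R;
  adm_d : Num.sqrt (P%:R / (c_ L)%:R) = (d_ L)%:R :> R;
  adm_b : n_ L = (d_ L * b_ L)%N;
  adm_mu : (c_ L <= mu_ L <= d_ L)%N;
  adm_q : d_ L = (q_ L * mu_ L)%N;
  adm_eta : 2%:R * (mu_ L)%:R / Num.sqrt ((c_ L)%:R * P%:R) <= eta <= 1;
  adm_s : (s_ L)%:R ^+ 2
          = 2%:R * eta * (mu_ L)%:R * Num.sqrt ((c_ L)%:R * P%:R);
  adm_bh : (2 * B_ L)%N = (s_ L * bh_ L)%N }.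

Definition proc (L : layout) : finType :=
  ('I_(d_ L) * 'I_(d_ L) * 'I_(c_ L))%type.

Section Tiles.
Context {L : layout}.
Implicit Types a : proc L.

(* Coarse row and column, position in the tile, layer (0 is the top layer). *)
Definition crow a : nat := (a.1.1 %/ mu_ L)%N.
Definition ccol a : nat := (a.1.2 %/ mu_ L)%N.
Definition frow a : nat := (a.1.1 %% mu_ L)%N.
Definition fcol a : nat := (a.1.2 %% mu_ L)%N.
Definition layer a : nat := a.2.

Definition slab (X Y Z : pred nat) : {set proc L} :=
  [set a | [&& X (crow a), Y (ccol a) & Z (layer a)]]%SET.

Definition tile (I J : nat) : {set proc L} := slab (pred1 I) (pred1 J) (pred1 0).

Definition same_pos (a a' : proc L) : bool :=
  (frow a == frow a') && (fcol a == fcol a').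

End Tiles.

(* Pl I J u v is the processor of the grid for the subproblem (I, J) that is
   placed at the grid position (u, v). *)
Definition placement (L : layout) : Type :=
  'I_(q_ L) -> 'I_(q_ L) -> 'I_(s_ L) -> 'I_(s_ L) -> proc L.

Definition placement_ok (L : layout) (Pl : placement L) : Prop :=
  forall I J : 'I_(q_ L), (I < J)%N ->
    injective (fun uv => Pl I J uv.1 uv.2) /\
    forall u v, Pl I J u v \in slab predT (pred2 (I : nat) (J : nat)) predT.

(** * 2D parallel Jacobi *)

Section Sweep2D.
Context {R : realType} {T : finType} (M : machine R).
Variables (s bh : nat) (at_ : 'I_s -> 'I_s -> T).

Let w := (bh ^ 2)%N.

Definition block_row (I : 'I_s) : {set T} := [set at_ I K | K : 'I_s]%SET.
Definition block_col (I : 'I_s) : {set T} := [set at_ K I | K : 'I_s]%SET.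

(* One product-sum X Y + X' Y' of blocks. *)
Definition update2d (a : T) : task R T :=
  local a (2%:R * matmul_flops M bh + w%:R).

Definition pair2d (p : 'I_s * 'I_s) : task R T :=
  let I := p.1 in let J := p.2 in
  let others := [seq K <- enum 'I_s | (K != I) && (K != J)] in
  serial
    [:: par [:: send M (at_ I I) (at_ I J) w; send M (at_ J J) (at_ I J) w];
        local (at_ I J) (diag_flops M (2 * bh));
        (* V11, V21, D11; V12, V22, D22; D21 *)
        par [:: send M (at_ I J) (at_ I I) (3 * w);
                send M (at_ I J) (at_ J J) (3 * w);
                send M (at_ I J) (at_ J I) w];
        (* rows of M; columns of M; columns of Q *)
        par ([seq exchange M (at_ I K) (at_ J K) w | K <- others]
          ++ [seq exchange M (at_ K I) (at_ K J) w | K <- others]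
          ++ [seq exchange M (at_ K I) (at_ K J) w | K <- enum 'I_s]);
        par [:: bcast (block_row I) (2 * w); bcast (block_col I) (2 * w);
                bcast (block_row J) (2 * w); bcast (block_col J) (2 * w)];
        par ([seq update2d (at_ I K) | K <- others]
          ++ [seq update2d (at_ J K) | K <- others]
          ++ [seq update2d (at_ K I) | K <- others]
          ++ [seq update2d (at_ K J) | K <- others]
          ++ [seq update2d (at_ K I) | K <- enum 'I_s]
          ++ [seq update2d (at_ K J) | K <- enum 'I_s])].

Definition sweep2d : task R T :=
  serial [seq par [seq pair2d p | p <- antidiag s K] | K <- iota 0 s].

End Sweep2D.

(** * 2.5D parallel Jacobi *)

Section Sweep25D.
Context {R : realType} (M : machine R).
Variable L : layout.

Let w := (b_ L ^ 2)%N.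

(* Operations on coarse tiles of the top layer, between the processors at equal
   positions of the tiles. *)
Definition between (op : proc L -> proc L -> task R (proc L))
    (X Y : {set proc L}) : task R (proc L) :=
  par [seq op aa.1 aa.2 |
        aa <- enum {: proc L * proc L} &
        [&& aa.1 \in X, aa.2 \in Y & same_pos aa.1 aa.2]].

Definition send_tile (X Y : {set proc L}) : task R (proc L) :=
  between (fun a a' => send M a a' w) X Y.

Definition exchange_tile (X Y : {set proc L}) : task R (proc L) :=
  between (fun a a' => exchange M a a' w) X Y.

(* Two fine blocks are broadcast along the coarse row and the coarse column of
   the tile (I, I). *)
Definition bcast_tile (I : nat) : task R (proc L) :=
  par ([seq bcast [set a' in slab (pred1 I) predT (pred1 0) | same_pos a a']%SET
              (2 * w) | a <- enum (tile I I)]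
    ++ [seq bcast [set a' in slab predT (pred1 I) (pred1 0) | same_pos a a']%SET
              (2 * w) | a <- enum (tile I I)]).

(* Transposition, in the tile (I, J), of the two tiles of V broadcast to it. *)
Definition transpose_tile (I J : nat) : task R (proc L) :=
  par [seq exchange M aa.1 aa.2 (2 * w) |
        aa <- enum {: proc L * proc L} &
        [&& aa.1 \in tile I J, aa.2 \in tile I J, frow aa.1 == fcol aa.2,
            fcol aa.1 == frow aa.2 & (frow aa.1 < fcol aa.1)%N]].

(* X Y + X' Y' for B x B tiles, over ProcSlab(I, J, :). *)
Definition update_tile (I J : nat) : task R (proc L) :=
  let X := slab (pred1 I) (pred1 J) predT in
  serial [:: mm25_task M X (B_ L) (c_ L); mm25_task M X (B_ L) (c_ L);
             par [seq local a w%:R | a <- enum (tile I J)]].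

Definition update_row_tile (I J : nat) : task R (proc L) :=
  serial [:: transpose_tile I J; update_tile I J].

Variable Pl : placement L.

(* Row (column) of the fine block of [a] in the 2mu x 2mu array of fine blocks
   of the subproblem (I, J). *)
Definition sub_row (J : nat) (a : proc L) : nat :=
  ((crow a == J) * mu_ L + frow a)%N.
Definition sub_col (J : nat) (a : proc L) : nat :=
  ((ccol a == J) * mu_ L + fcol a)%N.

(* Do the ranges [x b, (x+1) b) and [u bh, (u+1) bh) meet? *)
Definition overlap (x u : nat) : bool :=
  (x * b_ L < u.+1 * bh_ L)%N && (u * bh_ L < x.+1 * b_ L)%N.

(* The processor [a] and the grid processors holding a part of its block. *)
Definition scatter_group (p : 'I_(q_ L) * 'I_(q_ L)) (a : proc L) :
    {set proc L} :=
  (a |: [set Pl p.1 p.2 uv.1 uv.2 | uv : 'I_(s_ L) * 'I_(s_ L) &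
          overlap (sub_row p.2 a) uv.1 && overlap (sub_col p.2 a) uv.2])%SET.

(* [k] sweeps of the 2D algorithm are applied to the subproblem p = (I, J). *)
Definition pair25d (k : nat) (p : 'I_(q_ L) * 'I_(q_ L)) : task R (proc L) :=
  let I := p.1 in let J := p.2 in
  let owners : {set proc L} := slab (pred2 (I : nat) (J : nat)) (pred2 (I : nat) (J : nat))
                     (pred1 0) in
  let all := iota 0 (q_ L) in
  let others := [seq K : nat <- all | (K != I :> nat) && (K != J :> nat)] in
  serial
    [:: par [seq scatter (scatter_group p a) w | a <- enum owners];
        serial (nseq k (sweep2d M (bh_ L) (Pl I J)));
        (* both \hat A and \hat V *)
        par [seq gather (scatter_group p a) (2 * w) | a <- enum owners];
        par [:: send_tile (tile J I) (tile I I); send_tile (tile I J) (tile J J)];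
        par ([seq exchange_tile (tile I K) (tile J K) | K <- others]
          ++ [seq exchange_tile (tile K I) (tile K J) | K <- others]
          ++ [seq exchange_tile (tile K I) (tile K J) | K <- all]);
        par [:: bcast_tile I; bcast_tile J];
        par ([seq update_row_tile I K | K <- others]
          ++ [seq update_row_tile J K | K <- others]
          ++ [seq update_tile K I | K <- others]
          ++ [seq update_tile K J | K <- others]
          ++ [seq update_tile K I | K <- all]
          ++ [seq update_tile K J | K <- all])].

Variables (eig : forall k, 'M[R]_k -> 'M[R]_k * 'M[R]_k)
          (conv : forall k, 'M[R]_k -> bool) (maxit : nat).

(* Sweeps of 2D Jacobi until [conv] holds, or [fuel] sweeps have been made; also
   returns the number of sweeps made. *)
Fixpoint run2d (fuel : nat) (AV : 'M[R]_(2 * B_ L) * 'M[R]_(2 * B_ L)) :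
    nat * ('M[R]_(2 * B_ L) * 'M[R]_(2 * B_ L)) :=
  if fuel is f.+1 then
    if conv AV.1 then (0%N, AV)
    else let r := run2d f (@jacobi_sweep R _ (bh_ L) (s_ L) (@eig _) AV) in
         (r.1.+1, r.2)
  else (0%N, AV).

Definition solve2d (A : 'M[R]_(2 * B_ L)) :=
  let AV := (run2d maxit (A, 1%:M)).2 in (AV.2, AV.1).

Definition num_sweeps2d (A : 'M[R]_(2 * B_ L)) : nat :=
  (run2d maxit (A, 1%:M)).1.

(* The matrices (A, Q) after t sweeps of 2.5D Jacobi. *)
Definition state25d (A : 'M[R]_(n_ L)) (t : nat) : 'M[R]_(n_ L) * 'M[R]_(n_ L) :=
  iter t (@jacobi_sweep R _ (B_ L) (q_ L) solve2d) (A, 1%:M).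

(* The number of 2D sweeps applied to the subproblem p of the group K in the
   sweep that follows the first t ones. *)
Definition inner_sweeps (A : 'M[R]_(n_ L)) (t K : nat)
    (p : 'I_(q_ L) * 'I_(q_ L)) : nat :=
  num_sweeps2d (subproblem (B_ L) p
    (@jacobi_groups R _ (B_ L) (q_ L) solve2d (state25d A t) K).1).

Definition sweep25d (A : 'M[R]_(n_ L)) (t : nat) : task R (proc L) :=
  serial [seq par [seq pair25d (inner_sweeps A t K p) p | p <- antidiag (q_ L) K]
         | K <- iota 0 (q_ L)].

End Sweep25D.

(* Main.v *)
(* Write P = c d^2, so that sqrt (cP) = c d and mu is of order d/c.  The pairs of
   a group are disjoint, hence the row or the column of a processor brings it
   into at most one pair each, and parallel subproblems cost at most twice the
   most expensive one.  Within a subproblem, every parallel step puts boundedly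
   many tasks on each processor, and both the 2.5D products and the O(1) sweeps
   of 2D Jacobi on a grid of side s = sqrt (2 mu c d) = Theta(d) cost
     O(d log P) messages, O(mu b^2 / c) words, O(mu b^3 / c) flops.
   Multiplying by the number d / mu = O(c) of groups gives the claim, since
   log P = O(log (P/c)) as c <= d. *)
Require Import Defs.
From HB Require Import structures.
From mathcomp Require Import all_boot all_order all_algebra.
From mathcomp Require Import all_classical all_reals all_analysis.
From mathcomp Require Import ring lra zify.
Set Implicit Arguments.
Unset Strict Implicit.
Unset Printing Implicit Defensive.
Import Order.TTheory GRing.Theory Num.Theory.
Local Open Scope ring_scope.

(** * Counting *)

(** Since [par] serialises tasks that share a processor, a bound on cost alone does not compose:
    each bound carries a set containing the participants and is a multiple of a reference cost.
    Parallel composition then becomes a count of the sets that contain a given processor. The two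
    halves of the assumption on mu act at different places. The upper bound mu c <= theta2 d
    controls the inner solver: it gives s = O(d), hence few groups in a 2D sweep, and mu c = O(s),
    hence blocks small enough for the word bound, because s bh = 2 mu b makes s bh^2 = 4 (mu b)^2 /
    s. The lower bound gives q = d / mu <= c / theta1 and serves for the messages; in words and
    flops each subproblem carries a factor mu, and q mu = d exactly. Finally c <= mu makes a fine
    block cost no more than the reference, b^2 <= mu b^2 / c, which absorbs every transfer of
    boundedly many fine blocks. *)

Lemma count_le1 (I : eqType) (a : pred I) (s : seq I) :
  uniq s -> {in s &, forall x y, a x -> a y -> x = y} -> (count a s <= 1)%N.
Proof.
move=> us h; rewrite -size_filter.
have : uniq (seq.filter a s) by rewrite filter_uniq.
have {h} : {in seq.filter a s &, forall x y, x = y}.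
  move=> x y; rewrite !mem_filter => /andP[ax xs] /andP[ay ys].
  exact: h.
case: (seq.filter a s) => [|x [|y l]] // h /= /andP[].
by rewrite (h x y) ?inE ?eqxx ?orbT.
Qed.

Lemma count_leD (I : Type) (a a1 a2 : pred I) (s : seq I) (m1 m2 : nat) :
  (forall x, a x -> a1 x || a2 x) -> (count a1 s <= m1)%N ->
  (count a2 s <= m2)%N -> (count a s <= m1 + m2)%N.
Proof.
move=> h h1 h2; apply: leq_trans (leq_add h1 h2).
by rewrite -count_predUI (leq_trans (sub_count _ _) (leq_addr _ _)).
Qed.

Lemma count_le_image (I J : eqType) (a : pred I) (s : seq I) (f : I -> J)
    (t : seq J) :
  uniq s -> {in s &, forall x y, a x -> a y -> f x = f y -> x = y} ->
  {in s, forall x, a x -> f x \in t} -> (count a s <= size t)%N.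
Proof.
move=> us inj sub; rewrite -size_filter -(size_map f).
apply: uniq_leq_size => [|y /mapP[x]]; last first.
  by rewrite mem_filter => /andP[ax xs] ->; exact: sub.
rewrite map_inj_in_uniq ?filter_uniq// => x y.
by rewrite !mem_filter => /andP[ax xs] /andP[ay ys]; exact: inj.
Qed.

(* The pairs of a group are disjoint, so an index lies in at most one of them. *)
Lemma antidiag_count1 (q K r : nat) :
  (count (fun p : 'I_q * 'I_q => (p.1 == r :> nat) || (p.2 == r :> nat)) (antidiag q K)
     <= 1)%N.
Proof.
apply: count_le1; first by rewrite filter_uniq// enum_uniq.
move=> [i j] [i' j']; rewrite !mem_filter/=.
move=> /andP[/andP[ij /eqP hK] _] /andP[/andP[ij' /eqP hK'] _] h h'.
have E : (i.+1 + j.+1 = i'.+1 + j'.+1 %[mod q])%N by rewrite hK hK'.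
have inj (x y : 'I_q) (z : nat) :
    (z.+1 + x.+1 = z.+1 + y.+1 %[mod q])%N -> x = y.
  rewrite -[x.+1]addn1 -[y.+1]addn1 !addnA ![(z.+1 + _ + 1)%N]addnAC.
  move=> /eqP; rewrite eqn_modDl => /eqP.
  by rewrite !modn_small// => /val_inj.
case/orP: h => /eqP h; case/orP: h' => /eqP h'.
- have e : i = i' by apply: ord_inj; rewrite h h'.
  by rewrite e in E *; rewrite (inj _ _ _ E).
(* If the shared index is the smaller one of one pair and the larger one of the other, cancelling it
   makes the pairs mirror images, against [i < j] and [i' < j']. *)
- have e : i = j' by apply: ord_inj; rewrite h h'.
  move: E ij ij'; rewrite e [(i'.+1 + _)%N]addnC => /inj ->.
  by move=> /ltnW; rewrite leqNgt => /negbTE ->.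
- have e : j = i' by apply: ord_inj; rewrite h h'.
  move: E ij ij'; rewrite e [(i.+1 + _)%N]addnC => /inj ->.
  by move=> /ltnW; rewrite leqNgt => /negbTE ->.
- have e : j = j' by apply: ord_inj; rewrite h h'.
  by move: E; rewrite e ![(_ + j'.+1)%N]addnC => /inj ->.
Qed.

Lemma antidiag_count2 (q K r t : nat) :
  (count (fun p : 'I_q * 'I_q => [|| p.1 == r :> nat, p.2 == r :> nat,
                     p.1 == t :> nat | p.2 == t :> nat]) (antidiag q K)
     <= 2)%N.
Proof.
apply: count_leD (antidiag_count1 q K r) (antidiag_count1 q K t) => p.
by rewrite !orbA.
Qed.

(** * Composition of costs *)

Section Within.
Context {R : realType} (T : finType).
Implicit Types (u : cost R) (S : {set T}) (k : R) (x : task R T)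
  (l : seq (task R T)).

(** One coefficient [k] serves all three components, so serial composition adds coefficients. [S]
    may exceed the true set of participants; this lets a uniform set, such as a union of rows and
    columns, stand for it when counting. *)
Definition cost_within u S k x : Prop :=
  [/\ who x \subset S, msgs (tcost x) <= k * msgs u,
      words (tcost x) <= k * words u & flops (tcost x) <= k * flops u].

(** The first two bounds let one unit absorb a point-to-point message and a collective on any set of
    processors; nonnegativity allows coefficients to be enlarged. *)
Definition cost_unit u : Prop :=
  [/\ 1 <= msgs u, log2 #|T|%:R <= msgs u, 0 <= words u & 0 <= flops u].

Lemma within_weaken u u' S S' k k' x :
  cost_within u S k x -> S \subset S' -> k * msgs u <= k' * msgs u' ->
  k * words u <= k' * words u' -> k * flops u <= k' * flops u' ->
  cost_within u' S' k' x.
Proof.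
case=> hS hm hw hf SS' h1 h2 h3; split; first exact: fintype.subset_trans SS'.
- exact: le_trans h1.
- exact: le_trans h2.
- exact: le_trans h3.
Qed.

Lemma withinS u S S' k x : cost_within u S k x -> S \subset S' -> cost_within u S' k x.
Proof. by move=> h SS'; apply: within_weaken h SS' _ _ _. Qed.

Lemma within_mono u S k k' x :
  cost_unit u -> k <= k' -> cost_within u S k x -> cost_within u S k' x.
Proof.
move=> [h1 _ h2 h3] kk' h; apply: within_weaken h _ _ _ _ => //;
  by rewrite ler_wpM2r// (le_trans ler01).
Qed.

Lemma participants_cons x l : participants (x :: l) = (who x :|: participants l)%SET.
Proof. by rewrite /participants big_cons. Qed.

Lemma participants_cat l1 l2 :
  participants (l1 ++ l2) = (participants l1 :|: participants l2)%SET.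
Proof. by rewrite /participants big_cat. Qed.

Lemma serial_nil u S : cost_within u S 0 (serial [::]).
Proof.
by split; rewrite /= ?big_nil ?mul0r//; rewrite /participants big_nil finset.sub0set.
Qed.

Lemma serial_cons u S k k' x l :
  cost_within u S k x -> cost_within u S k' (serial l) ->
  cost_within u S (k + k') (serial (x :: l)).
Proof.
move=> [h1 h2 h3 h4] [h1' h2' h3' h4']; split => /=.
- by rewrite participants_cons finset.subUset h1.
- by rewrite big_cons mulrDl lerD.
- by rewrite big_cons mulrDl lerD.
- by rewrite big_cons mulrDl lerD.
Qed.

Lemma serial_map (I : eqType) u S k (s : seq I) (F : I -> task R T) :
  {in s, forall i, cost_within u S k (F i)} ->
  cost_within u S ((size s)%:R * k) (serial [seq F i | i <- s]).
Proof.
elim: s => [|i s IH] h; first by rewrite mul0r; exact: serial_nil.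
rewrite /= mulrSr addrC mulrDl mul1r; apply: serial_cons.
  by apply: h; rewrite inE eqxx.
by apply: IH => j js; apply: h; rewrite inE js orbT.
Qed.

Lemma par_with_le (f : cost R -> R) l (B : R) : 0 <= B ->
  (forall p, \sum_(x <- l | p \in who x) f (tcost x) <= B) ->
  par_with f l <= B.
Proof. by move=> B0 h; apply: bigmax_le. Qed.

Lemma le_par_with (f : cost R -> R) l p :
  \sum_(x <- l | p \in who x) f (tcost x) <= par_with f l.
Proof. exact: (le_bigmax _ (fun p => \sum_(x <- l | p \in who x) f (tcost x))). Qed.

Lemma par_with_ge0 (f : cost R -> R) l : 0 <= par_with f l.
Proof. exact: bigmax_ge_id. Qed.

Lemma par_nil u S : cost_within u S 0 (par [::]).
Proof.
split; rewrite /= ?mul0r; last 3 first.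
- by apply: par_with_le => // p; rewrite big_nil.
- by apply: par_with_le => // p; rewrite big_nil.
- by apply: par_with_le => // p; rewrite big_nil.
by rewrite /participants big_nil finset.sub0set.
Qed.

(** The load of a processor is a sum over the list, so loads of two families add and so do their
    maxima, whether or not the families share processors. *)
Lemma par_cat u S k k' l l' :
  cost_within u S k (par l) -> cost_within u S k' (par l') ->
  cost_within u S (k + k') (par (l ++ l')).
Proof.
have aux (f : cost R -> R) : par_with f l <= k * f u ->
    par_with f l' <= k' * f u -> par_with f (l ++ l') <= (k + k') * f u.
  move=> h h'; rewrite mulrDl; apply: par_with_le => [|p].
    by rewrite addr_ge0// (le_trans _ h, le_trans _ h')// par_with_ge0.
  rewrite big_cat lerD//; first exact: le_trans (le_par_with _ _ _) h.
  exact: le_trans (le_par_with _ _ _) h'.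
move=> [h1 h2 h3 h4] [h1' h2' h3' h4']; split => /=.
- by rewrite participants_cat finset.subUset h1.
- exact: (aux (@msgs R)).
- exact: (aux (@words R)).
- exact: (aux (@flops R)).
Qed.

(* [N] bounds the number of tasks that are serialised on a processor. *)
Lemma par_map (I : eqType) u S (S_ : I -> {set T}) (N : nat) k (s : seq I)
    (F : I -> task R T) :
  cost_unit u -> 0 <= k ->
  {in s, forall i, cost_within u (S_ i) k (F i)} ->
  {in s, forall i, S_ i \subset S} ->
  (forall y, (count (fun i => y \in S_ i) s <= N)%N) ->
  cost_within u S (N%:R * k) (par [seq F i | i <- s]).
Proof.
move=> [u1 _ u2 u3] k0 hF hS hN.
have aux (f : cost R -> R) : 0 <= f u ->
    {in s, forall i, f (tcost (F i)) <= k * f u} ->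
    par_with f [seq F i | i <- s] <= N%:R * k * f u.
  move=> fu0 hf; apply: par_with_le => [|p]; first by rewrite !mulr_ge0.
  (* Passing from [who] to the larger [S_ i] only adds terms [k * f u], which are nonnegative. *)
  rewrite big_map; apply: (@le_trans _ _ (\sum_(i <- s | p \in S_ i) k * f u)).
    rewrite big_mkcond [leRHS]big_mkcond big_seq [leRHS]big_seq.
    apply: ler_sum => i si; case: ifPn => [pw|_].
      have [/fintype.subsetP/(_ p pw) -> _ _ _] := hF i si.
      exact: hf.
    by case: ifP => // _; rewrite mulr_ge0.
  rewrite big_const_seq iter_addr_0 -[leLHS]mulr_natl -mulrA.
  by rewrite ler_wpM2r ?mulr_ge0// ler_nat.
split => /=.
- rewrite /participants big_map big_seq.
  elim/big_rec: _ => [|i X si XS]; first exact: finset.sub0set.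
  have [h _ _ _] := hF i si.
  by rewrite finset.subUset XS (fintype.subset_trans h (hS i si)).
- by apply: (aux (@msgs R)) => [|i /hF[]//]; rewrite (le_trans ler01).
- by apply: (aux (@words R)) => // i /hF[].
- by apply: (aux (@flops R)) => // i /hF[].
Qed.

Lemma par_cons u S k k' x l : cost_unit u -> 0 <= k ->
  cost_within u S k x -> cost_within u S k' (par l) ->
  cost_within u S (k + k') (par (x :: l)).
Proof.
move=> hu k0 hx hl; rewrite -cat1s; apply: par_cat => //.
rewrite -[k]mul1r; apply: (@par_map unit u S (fun=> S) 1 k [:: tt] (fun=> x)) => //.
by move=> y /=; case: (_ \in _).
Qed.

(** * Costs of the primitives *)

Lemma log2_card_le (X : {set T}) : log2 #|X|%:R <= log2 #|T|%:R :> R.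
Proof.
rewrite /log2 ler_wpM2r ?invr_ge0 ?ln_ge0 ?ler1n//.
(* [ln 0] is 0 by convention, so the empty set needs its own case: monotonicity of [ln] holds on
   positive numbers. *)
have [X0|X0] := posnP #|X|.
  rewrite X0 ln0//; case: (posnP #|T|) => [->|T0]; first by rewrite ln0.
  by rewrite ln_ge0// ler1n.
by rewrite ler_ln ?posrE ?ltr0n ?ler_nat ?max_card// (leq_trans X0 (max_card _)).
Qed.

Lemma scatter_within u (X : {set T}) (w : nat) (m : R) : cost_unit u ->
  1 <= m -> w%:R <= m * words u -> cost_within u X m (scatter X w).
Proof.
move=> [u1 u1' u2 u3] m1 hw; have m0 := le_trans ler01 m1; split => //=.
- apply: le_trans (log2_card_le X) (le_trans u1' _).
  by rewrite ler_peMl// (le_trans ler01).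
- by rewrite mulr_ge0.
Qed.

Lemma bcast_within u (X : {set T}) (w : nat) (m : R) : cost_unit u ->
  1 <= m -> w%:R <= m * words u -> cost_within u X (2 * m) (bcast X w).
Proof.
move=> hu m1 /(scatter_within X hu m1)[? h2 h3 ?]; case: hu => ? ? ? ?.
split=> //=; rewrite -?mulrA ?ler_wpM2l//.
by rewrite !mulr_ge0// (le_trans ler01).
Qed.

Lemma local_within u a (f : R) k : cost_unit u -> 0 <= k ->
  f <= k * flops u -> cost_within u [set a]%SET k (local a f).
Proof.
move=> [? ? ? ?] k0 hf; split=> //=; rewrite mulr_ge0//.
by rewrite (le_trans ler01).
Qed.

Variables (kappa : R) (M : machine R).
Hypotheses (kappa0 : 0 <= kappa) (HM : machine_bounds kappa M).

Lemma send_within u a b (w : nat) (m : R) : cost_unit u -> 1 <= m ->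
  w%:R <= m * words u -> cost_within u [set a; b]%SET (kappa * m) (send M a b w).
Proof.
move=> [u1 _ u2 u3] m1 hw; have m0 := le_trans ler01 m1.
have /andP[_ h1] := send_msgsP HM w; have /andP[_ h2] := send_wordsP HM w.
split => //=.
- apply: le_trans h1 _; rewrite -mulrA ler_peMr// mulr_ege1//.
- by apply: le_trans h2 _; rewrite -mulrA ler_wpM2l.
- by rewrite !mulr_ge0.
Qed.

Lemma exchange_within u a b (w : nat) (m : R) : cost_unit u -> 1 <= m ->
  w%:R <= m * words u ->
  cost_within u [set a; b]%SET (2 * kappa * m) (exchange M a b w).
Proof.
move=> hu m1 hw.
have -> : 2 * kappa * m = kappa * m + (kappa * m + 0) by ring.
apply: serial_cons; first exact: send_within.
apply: serial_cons; last exact: serial_nil.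
by rewrite finset.setUC; exact: send_within.
Qed.

End Within.

(** * Sweeps of the 2D algorithm *)

Section Sweep2DCost.
Context {R : realType} {T : finType}.
Variables (kappa : R) (M : machine R).
Hypotheses (kappa0 : 0 <= kappa) (HM : machine_bounds kappa M).
Variables (s bh : nat) (at_ : 'I_s -> 'I_s -> T).
Hypothesis at_inj : injective (fun uv : 'I_s * 'I_s => at_ uv.1 uv.2).
Variable u : cost R.
Hypotheses (u_unit : cost_unit T u) (u_words : (bh ^ 2)%:R <= words u)
  (u_flops : (bh ^ 3)%:R <= flops u).

(** Contains every processor that the pair can involve. The crosses of disjoint pairs still meet,
    where a row of one crosses a column of the other; hence the bound 2 in [cross2d_count]. *)
Definition cross2d (p : 'I_s * 'I_s) : {set T} :=
  [set at_ uv.1 uv.2 | uv : 'I_s * 'I_s &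
     [|| p.1 == uv.1 :> nat, p.2 == uv.1 :> nat,
         p.1 == uv.2 :> nat | p.2 == uv.2 :> nat]]%SET.

Lemma at_eq a b a' b' : at_ a b = at_ a' b' -> a = a' /\ b = b'.
Proof. by move=> e; have [] : (a, b) = (a', b') by exact: at_inj. Qed.

Lemma mem_cross2d p a b :
  (at_ a b \in cross2d p) = [|| p.1 == a :> nat, p.2 == a :> nat,
                                p.1 == b :> nat | p.2 == b :> nat].
Proof.
apply/imsetP/idP => [[[a' b']]|h]; last by exists (a, b); rewrite ?inE.
by rewrite inE /= => h /at_eq[-> ->].
Qed.

Lemma cross2d_count K x :
  (count (fun p => x \in cross2d p) (antidiag s K) <= 2)%N.
Proof.
case: (pickP (fun uv : 'I_s * 'I_s => x == at_ uv.1 uv.2)) => [[a b] /eqP ->|h].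
  rewrite (eq_count (fun p => mem_cross2d p a b)).
  exact: antidiag_count2.
rewrite (@eq_count _ _ pred0) ?count_pred0// => p /=.
by apply/negP => /imsetP[uv _ /eqP]; rewrite h.
Qed.

(** By injectivity of the placement, a processor in row [a] or [b] determines [K], so it gets a
    single task and [k] is not multiplied. The case [a = b] covers local updates. *)
Lemma par_row (S : {set T}) k (a b : 'I_s) (l : seq 'I_s) F :
  0 <= k -> uniq l ->
  (forall K, cost_within u [set at_ a K; at_ b K]%SET k (F K)) ->
  (forall K, at_ a K \in S) -> (forall K, at_ b K \in S) ->
  cost_within u S k (par [seq F K | K <- l]).
Proof.
move=> k0 ul hF ha hb; rewrite -[k]mul1r.
apply: (@par_map _ _ _ u S (fun K => [set at_ a K; at_ b K]%SET) 1) => //.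
  by move=> K _; apply/fintype.subsetP => x /set2P[]->.
move=> x; apply: count_le1 => // K K' _ _.
by move=> /set2P[]-> /set2P[]/at_eq[].
Qed.

Lemma par_col (S : {set T}) k (a b : 'I_s) (l : seq 'I_s) F :
  0 <= k -> uniq l ->
  (forall K, cost_within u [set at_ K a; at_ K b]%SET k (F K)) ->
  (forall K, at_ K a \in S) -> (forall K, at_ K b \in S) ->
  cost_within u S k (par [seq F K | K <- l]).
Proof.
move=> k0 ul hF ha hb; rewrite -[k]mul1r.
apply: (@par_map _ _ _ u S (fun K => [set at_ K a; at_ K b]%SET) 1) => //.
  by move=> K _; apply/fintype.subsetP => x /set2P[]->.
move=> x; apply: count_le1 => // K K' _ _.
by move=> /set2P[]-> /set2P[]/at_eq[].
Qed.

(** The participant is written as a degenerate pair to fit [par_row] and [par_col] with [a = b]. *)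
Lemma update2d_within (a : T) :
  cost_within u [set a; a]%SET (2 * kappa + 1) (update2d M bh a).
Proof.
rewrite finset.setUid; apply: local_within => //.
  by rewrite addr_ge0 ?mulr_ge0.
have /andP[_ h] := matmul_flopsP HM bh.
have h1 : matmul_flops M bh <= kappa * flops u.
  by apply: le_trans h _; rewrite -natrX ler_wpM2l.
have h2 : (bh ^ 2)%:R <= flops u.
  apply: le_trans u_flops; rewrite ler_nat.
  by case: (bh) => // m; rewrite leq_pexp2l.
lra.
Qed.

Lemma pair2d_within p :
  cost_within u (cross2d p) (35 * kappa + 22) (pair2d M bh at_ p).
Proof.
case: p => I J; set S := cross2d _.
have rI K : at_ I K \in S by rewrite mem_cross2d eqxx.
have rJ K : at_ J K \in S by rewrite mem_cross2d /= eqxx !orbT.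
have cI K : at_ K I \in S by rewrite mem_cross2d /= eqxx !orbT.
have cJ K : at_ K J \in S by rewrite mem_cross2d /= eqxx !orbT.
have sub2 (x y : T) : x \in S -> y \in S -> [set x; y]%SET \subset S.
  by move=> xS yS; apply/fintype.subsetP => z /set2P[]->.
have sendS (x y : T) m : x \in S -> y \in S -> 1 <= m%:R :> R ->
    cost_within u S (kappa * m%:R) (send M x y (m * bh ^ 2)).
  move=> xS yS m1; apply: (@withinS _ _ _ [set x; y]%SET); last exact: sub2.
  by apply: (send_within kappa0 HM) => //; rewrite natrM ler_wpM2l.
have send1 (x y : T) : x \in S -> y \in S -> cost_within u S kappa (send M x y (bh ^ 2)).
  by move=> xS yS; rewrite -[kappa]mulr1 -[(bh ^ 2)%N]mul1n; exact: sendS.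
have exch (x y : T) : cost_within u [set x; y]%SET (2 * kappa) (exchange M x y (bh ^ 2)).
  rewrite -[2 * kappa]mulr1.
  by apply: (@exchange_within _ _ _ _ kappa0 HM _ _ _ _ 1); rewrite ?mul1r.
have bc (X : {set T}) : X \subset S -> cost_within u S 4 (bcast X (2 * bh ^ 2)).
  move=> XS; have -> : 4 = 2 * 2 :> R by ring.
  apply: withinS XS; apply: bcast_within => //; first by rewrite ler1n.
  by rewrite natrM ler_wpM2l.
have nil0 := par_nil u S.
have k0 : 0 <= 2 * kappa + 1 by rewrite addr_ge0 ?mulr_ge0.
have k2 : 0 <= 2 * kappa by rewrite mulr_ge0.
have k3 : 0 <= kappa * 3%:R by rewrite mulr_ge0.
have ul : uniq [seq K <- enum 'I_s | (K != I) && (K != J)].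
  by rewrite filter_uniq ?enum_uniq.
have ue := enum_uniq 'I_s.
(* One summand per stage: two blocks sent in; diagonalisation of order 2 bh, whence 8 = 2^3; 3 + 3 +
   1 blocks sent out; three families of exchanges; four broadcasts of two blocks; six families of
   updates. *)
apply: (@within_mono _ _ u S
  ((kappa + (kappa + 0)) + (8 * kappa +
   ((kappa * 3%:R + (kappa * 3%:R + (kappa + 0))) +
    ((2 * kappa + (2 * kappa + 2 * kappa)) +
     ((4 + (4 + (4 + (4 + 0)))) +
     (((2 * kappa + 1) + ((2 * kappa + 1) + ((2 * kappa + 1) +
       ((2 * kappa + 1) + ((2 * kappa + 1) + (2 * kappa + 1)))))) + 0))))))) => //.
  lra.
rewrite /pair2d; do !apply: serial_cons; last exact: serial_nil.
- do !apply: par_cons => //; exact: send1.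
- apply: (@withinS _ _ _ [set at_ I J]%SET); last by rewrite finset.sub1set.
  apply: local_within => //; first by rewrite mulr_ge0.
  have /andP[_ h] := diag_flopsP HM (2 * bh).
  have hf := ler_wpM2l kappa0 u_flops.
  have e : (2 * bh)%:R ^+ 3 = 8 * (bh ^ 3)%:R :> R by rewrite natrM natrX; ring.
  by rewrite e in h; lra.
- do !apply: par_cons => //.
  + by apply: sendS; rewrite ?ler1n.
  + by apply: sendS; rewrite ?ler1n.
  + exact: send1.
- do !apply: par_cat.
  + exact: par_row.
  + exact: par_col.
  + exact: par_col.
- have sr a : (forall K, at_ a K \in S) -> block_row at_ a \subset S.
    by move=> h; apply/fintype.subsetP => x /imsetP[K _ ->].
  have sc a : (forall K, at_ K a \in S) -> block_col at_ a \subset S.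
    by move=> h; apply/fintype.subsetP => x /imsetP[K _ ->].
  by do !apply: par_cons => //; apply: bc; [exact: sr|exact: sc|exact: sr|exact: sc].
- do !apply: par_cat.
  + by apply: (@par_row _ _ I I) => // K; exact: update2d_within.
  + by apply: (@par_row _ _ J J) => // K; exact: update2d_within.
  + by apply: (@par_col _ _ I I) => // K; exact: update2d_within.
  + by apply: (@par_col _ _ J J) => // K; exact: update2d_within.
  + by apply: (@par_col _ _ I I) => // K; exact: update2d_within.
  + by apply: (@par_col _ _ J J) => // K; exact: update2d_within.
Qed.

Lemma sweep2d_within (S : {set T}) : (forall a b, at_ a b \in S) ->
  cost_within u S (s%:R * (2 * (35 * kappa + 22))) (sweep2d M bh at_).
Proof.
move=> hS; rewrite -[s in s%:R](size_iota 0).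
apply: serial_map => K _.
apply: (@par_map _ _ _ u S cross2d) => //.
- by rewrite addr_ge0 ?mulr_ge0.
- by move=> p _; exact: pair2d_within.
- by move=> p _; apply/fintype.subsetP => x /imsetP[uv _ ->].
- exact: cross2d_count.
Qed.

End Sweep2DCost.

Lemma log2_ge1 (R : realType) (n : nat) : (1 < n)%N -> 1 <= log2 n%:R :> R.
Proof.
move=> n1; rewrite ler_pdivlMr ?ln_gt0 ?ltr1n// mul1r.
by rewrite ler_ln ?posrE ?ltr0n ?ler_nat// ltnW.
Qed.

(** * Grid dimensions *)

(** Admissibility at [eta = 1] turned into relations between naturals. [gf_d] makes the logarithms
    positive, and [gf_bhb] bounds the number of fine blocks that a block of the solver grid
    meets. *)
Record grid_facts (L : layout) : Prop := GridFacts {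
  gf_b : (0 < b_ L)%N;
  gf_c : (0 < c_ L)%N;
  gf_cmu : (c_ L <= mu_ L)%N;
  gf_mud : (mu_ L <= d_ L)%N;
  gf_d : (1 < d_ L)%N;
  gf_q : d_ L = (q_ L * mu_ L)%N;
  gf_s : (s_ L ^ 2 = 2 * mu_ L * (c_ L * d_ L))%N;
  gf_bh : (2 * (mu_ L * b_ L) = s_ L * bh_ L)%N;
  gf_bhb : (bh_ L <= b_ L)%N }.

Section Admissible.
Context {R : realType}.
Variables (P : nat) (eta : R) (L : layout).
Hypothesis (adm : admissible P eta L).

Let c0 : (0 : R) < (c_ L)%:R.
Proof. by rewrite ltr0n; case: adm. Qed.

Lemma admissible_P : P%:R = (c_ L)%:R * (d_ L)%:R ^+ 2 :> R.
Proof.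
rewrite -(adm_d adm) sqr_sqrtr ?divr_ge0//.
by rewrite mulrC divfK// gt_eqF.
Qed.

Lemma admissible_sqrt_cP :
  Num.sqrt ((c_ L)%:R * P%:R) = (c_ L)%:R * (d_ L)%:R :> R.
Proof.
have -> : (c_ L)%:R * P%:R = ((c_ L)%:R * (d_ L)%:R) ^+ 2 :> R.
  by rewrite admissible_P; ring.
by rewrite sqrtr_sqr ger0_norm ?mulr_ge0.
Qed.

Lemma admissible_sqrt_Pc3 :
  Num.sqrt (P%:R / (c_ L)%:R ^+ 3) = (d_ L)%:R / (c_ L)%:R :> R.
Proof.
have -> : P%:R / (c_ L)%:R ^+ 3 = ((d_ L)%:R / (c_ L)%:R) ^+ 2 :> R.
  by rewrite admissible_P; field; rewrite gt_eqF.
by rewrite sqrtr_sqr ger0_norm ?divr_ge0.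
Qed.

Lemma admissible_facts : eta = 1 -> grid_facts L.
Proof.
move=> eta1; case: (adm) => n0 c1 _ _ nb /andP[cmu mud] dq /andP[he _] hs hbh.
move: n0; rewrite nb muln_gt0 => /andP[d0 b0].
have mu0 := leq_trans c1 cmu.
(* This is the lower bound on the utilization factor. With c <= mu it forces d >= 2; with s^2 = 2 mu
   c d it gives s >= 2 mu, and then bh <= b because s bh = 2 mu b. *)
have h2 : (2 * mu_ L <= c_ L * d_ L)%N.
  move: he; rewrite admissible_sqrt_cP eta1 ler_pdivrMr ?mulr_gt0 ?ltr0n//.
  by rewrite mul1r -!natrM ler_nat.
have hs' : (s_ L ^ 2 = 2 * mu_ L * (c_ L * d_ L))%N.
  move: hs; rewrite admissible_sqrt_cP eta1 mulr1 -natrX -!natrM => /eqP.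
  by rewrite eqr_nat => /eqP.
have s2 : (2 * mu_ L <= s_ L)%N.
  by rewrite -leq_sqr hs' expnS expn1 leq_mul2l h2 orbT.
split => //; first by nia.
rewrite -(@leq_pmul2l (s_ L)); last by lia.
rewrite -hbh /B_ mulnA leq_mul2r s2 orbT//.
Qed.

End Admissible.

(** * Tiles and slabs of processors *)

Section Slabs.
Variables (L : layout).
Hypothesis (facts : grid_facts L).
Implicit Types a : proc L.

Let mu0 : (0 < mu_ L)%N := leq_trans (gf_c facts) (gf_cmu facts).

Lemma mem_slab (X Y Z : pred nat) a :
  (a \in slab X Y Z) = [&& X (crow a), Y (ccol a) & Z (layer a)].
Proof. by rewrite inE. Qed.

Lemma proc_eq a a' : crow a = crow a' -> ccol a = ccol a' ->
  frow a = frow a' -> fcol a = fcol a' -> layer a = layer a' -> a = a'.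
Proof.
case: a a' => [[x y] z] [[x' y'] z']; rewrite /crow /ccol /frow /fcol /layer /=.
move=> hx hy kx ky hz; do 2?congr pair; apply: ord_inj => //.
  by rewrite (divn_eq x (mu_ L)) hx kx -divn_eq.
by rewrite (divn_eq y (mu_ L)) hy ky -divn_eq.
Qed.

Lemma tile_eq r t a a' : a \in tile r t -> a' \in tile r t ->
  frow a = frow a' -> fcol a = fcol a' -> a = a'.
Proof.
rewrite !mem_slab /= => /and3P[/eqP h1 /eqP h2 /eqP h3].
move=> /and3P[/eqP h1' /eqP h2' /eqP h3'] h4 h5.
by apply: proc_eq => //; rewrite ?h1 ?h2 ?h3.
Qed.

Lemma card_coarse (I : nat) : (I < q_ L)%N ->
  #|[set i : 'I_(d_ L) | (i %/ mu_ L == I)%N]%SET| = mu_ L.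
Proof.
move=> Iq.
have lt (k : 'I_(mu_ L)) : (I * mu_ L + k < d_ L)%N.
  rewrite (gf_q facts); apply: (@leq_trans (I.+1 * mu_ L)).
    by rewrite mulSn addnC ltn_add2r.
  by rewrite leq_mul2r Iq orbT.
pose f k := Ordinal (lt k).
have injf : injective f by move=> k k' [] /addnI/ord_inj.
rewrite -[RHS]card_ord -(card_imset _ injf); apply: eq_card => i.
rewrite inE; apply/eqP/imsetP => [h|[k _ ->]] /=.
  exists (Ordinal (ltn_pmod i mu0)) => //.
  by apply: ord_inj => /=; rewrite -h -divn_eq.
by rewrite divnMDl// divn_small// addn0.
Qed.

Lemma card_slab (I J : nat) : (I < q_ L)%N -> (J < q_ L)%N ->
  #|@slab L (pred1 I) (pred1 J) predT| = (mu_ L ^ 2 * c_ L)%N.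
Proof.
pose A (K : nat) := [set i : 'I_(d_ L) | (i %/ mu_ L == K)%N]%SET.
move=> Iq Jq; have -> : slab (pred1 I) (pred1 J) predT =
    finset.setX (finset.setX (A I) (A J)) [set: 'I_(c_ L)]%SET :> {set proc L}.
  by apply/finset.setP => -[[x y] z]; rewrite !inE /= !andbT.
by rewrite !cardsX cardsT card_ord !card_coarse// mulnn.
Qed.

Lemma card_proc : #|proc L| = (d_ L * d_ L * c_ L)%N.
Proof. by rewrite !card_prod !card_ord. Qed.

Lemma card_proc_gt1 : (1 < #|proc L|)%N.
Proof.
apply: leq_trans (gf_d facts) _.
by rewrite card_proc -mulnA leq_pmulr// muln_gt0 (gf_c facts) ltnW ?(gf_d facts).
Qed.

(** A range of length bh <= b starts in the fine block of index floor(w bh / b) and cannot reach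
    beyond the next one. *)
Lemma overlap_bound r w : overlap L r w ->
  (r == w * bh_ L %/ b_ L)%N || (r == (w * bh_ L %/ b_ L).+1)%N.
Proof.
move=> /andP[h1 h2]; have b0 := gf_b facts; have bhb := gf_bhb facts.
have l1 : (w * bh_ L %/ b_ L < r.+1)%N by rewrite ltn_divLR.
have l2 : (r.-1 <= w * bh_ L %/ b_ L)%N.
  rewrite leq_divRL//; case: (r) h1 => //= y; rewrite !mulSn; lia.
lia.
Qed.

Lemma sub_index_inj (J r r' f f' : nat) (I : nat) :
  pred2 I J r -> pred2 I J r' -> (f < mu_ L)%N -> (f' < mu_ L)%N ->
  ((r == J) * mu_ L + f = (r' == J) * mu_ L + f')%N -> r = r' /\ f = f'.
Proof.
move=> /orP[]/eqP -> /orP[]/eqP -> hf hf' /=; rewrite ?eqxx.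
- by move=> /addnI.
- by case: eqP => [->|_] /=; lia.
- by case: eqP => [->|_] /=; lia.
- by move=> /addnI.
Qed.

End Slabs.

(** * Sweeps of the 2.5D algorithm *)

Section Sweep25DCost.
Context {R : realType}.
Variables (kappa : R) (M : machine R).
Hypotheses (kappa0 : 0 <= kappa) (HM : machine_bounds kappa M).
Variable L : layout.
Hypothesis (facts : grid_facts L).
Variable Pl : placement L.
Hypothesis (Pl_ok : placement_ok Pl).

Let b : R := (b_ L)%:R.
Let c : R := (c_ L)%:R.
Let d : R := (d_ L)%:R.
Let mu : R := (mu_ L)%:R.
Let s : R := (s_ L)%:R.
Let bh : R := (bh_ L)%:R.

(* Up to a constant, the cost of one subproblem; there are d / mu groups of
   subproblems, with d / mu of order c. *)
Definition unit25d : cost R :=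
  Cost ((d_ L)%:R * log2 #|proc L|%:R)
       ((mu_ L)%:R * (b_ L)%:R ^+ 2 / (c_ L)%:R)
       ((mu_ L)%:R * (b_ L)%:R ^+ 3 / (c_ L)%:R).
Let u := unit25d.

Let b1 : 1 <= b. Proof. by rewrite ler1n (gf_b facts). Qed.
Let c1 : 1 <= c. Proof. by rewrite ler1n (gf_c facts). Qed.
Let cmu : c <= mu. Proof. by rewrite ler_nat (gf_cmu facts). Qed.
Let mud : mu <= d. Proof. by rewrite ler_nat (gf_mud facts). Qed.
Let d2 : 2 <= d. Proof. by rewrite ler_nat (gf_d facts). Qed.
Let c0 : 0 < c. Proof. exact: lt_le_trans ltr01 c1. Qed.
Let mu0 : 0 < mu. Proof. exact: lt_le_trans c0 cmu. Qed.

Let c_ge0 := ltW c0.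
Let mu_ge0 := ltW mu0.
Let b_ge0 : 0 <= b. Proof. exact: le_trans ler01 b1. Qed.

Let lg1 := log2_ge1 R (card_proc_gt1 facts).

(** Holds because c <= mu: moving one fine block costs at most one unit of words. *)
Let b2_words : ((b_ L) ^ 2)%:R <= words u.
Proof.
rewrite natrX /= -/b -/c -/mu ler_pdivlMr// mulrC ler_wpM2r//.
by rewrite exprn_ge0.
Qed.

(** Follows from b >= 1, and absorbs the entrywise additions of the tile updates. *)
Let b2_flops : ((b_ L) ^ 2)%:R <= flops u.
Proof.
apply: le_trans b2_words _ => /=; rewrite -/b -/c -/mu.
rewrite ler_wpM2r ?invr_ge0// ler_wpM2l// [b ^+ 3]exprS ler_peMl//.
by rewrite exprn_ge0.
Qed.

Lemma unit25d_unit : cost_unit (proc L) unit25d.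
Proof.
have l0 : 0 <= log2 #|proc L|%:R :> R by rewrite (le_trans ler01).
split; last 2 first.
- by apply: le_trans b2_words.
- by apply: le_trans b2_flops.
- by apply: mulr_ege1 => //; rewrite (le_trans _ d2)// ler1n.
- by rewrite /= ler_peMl// (le_trans _ d2)// ler1n.
Qed.
Let uu := unit25d_unit.

(** All layers are included: the products use every layer above a tile, and a placement may use any
    processor of the coarse columns I and J. *)
Definition cross25d (p : 'I_(q_ L) * 'I_(q_ L)) : {set proc L} :=
  [set a : proc L | [|| p.1 == crow a :> nat, p.2 == crow a :> nat,
                        p.1 == ccol a :> nat | p.2 == ccol a :> nat]]%SET.

Lemma mem_cross25d p a :
  (a \in cross25d p) = [|| p.1 == crow a :> nat, p.2 == crow a :> nat,
                           p.1 == ccol a :> nat | p.2 == ccol a :> nat].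
Proof. by rewrite inE. Qed.

Lemma cross25d_count K x :
  (count (fun p => x \in cross25d p) (antidiag (q_ L) K) <= 2)%N.
Proof.
rewrite (eq_count (fun p => mem_cross25d p x)); exact: antidiag_count2.
Qed.

(** * Operations on coarse tiles *)

Lemma sub_set2 (S : {set proc L}) x y :
  x \in S -> y \in S -> [set x; y]%SET \subset S.
Proof. by move=> xS yS; apply/fintype.subsetP => z /set2P[]->. Qed.

Lemma sub_slab (X Y Z X' Y' Z' : pred nat) :
  subpred X X' -> subpred Y Y' -> subpred Z Z' ->
  slab X Y Z \subset (slab X' Y' Z' : {set proc L}).
Proof.
move=> hX hY hZ; apply/fintype.subsetP => a; rewrite !mem_slab.
by move=> /and3P[/hX -> /hY -> /hZ ->].
Qed.

(** Within a tile the position determines the processor, so a partner is unique. A processor thus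
    acts at most once on each side, which gives the factor 2 even if the tiles overlap. *)
Lemma between_within (op : proc L -> proc L -> task R (proc L)) k r t r' t' :
  0 <= k -> (forall a a', cost_within u [set a; a']%SET k (op a a')) ->
  cost_within u (tile r t :|: tile r' t')%SET (2 * k)
    (between op (tile r t) (tile r' t')).
Proof.
move=> k0 hop.
apply: (@par_map _ _ _ u _ (fun aa => [set aa.1; aa.2]%SET) 2) => //.
- move=> [a a']; rewrite mem_filter /= => /andP[/and3P[h h' _] _].
  by apply: sub_set2; rewrite finset.inE ?h ?h' ?orbT.
- move=> x; apply: (@count_leD _ _ (fun aa => aa.1 == x) (fun aa => aa.2 == x)
    _ 1 1) => [[a a'] /set2P[]->||]; rewrite ?eqxx ?orbT//.
  + apply: count_le1; first by rewrite filter_uniq// enum_uniq.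
    move=> [a a'] [e e']; rewrite !mem_filter /=.
    move=> /andP[/and3P[_ h /andP[/eqP f1 /eqP f2]] _].
    move=> /andP[/and3P[_ h' /andP[/eqP f1' /eqP f2']] _].
    move=> /eqP ea /eqP ee; rewrite ea ee in f1 f2 f1' f2' *; congr pair.
    by apply: (tile_eq h h'); rewrite -?f1 -?f2 -?f1' -?f2'.
  + apply: count_le1; first by rewrite filter_uniq// enum_uniq.
    move=> [a a'] [e e']; rewrite !mem_filter /=.
    move=> /andP[/and3P[h _ /andP[/eqP f1 /eqP f2]] _].
    move=> /andP[/and3P[h' _ /andP[/eqP f1' /eqP f2']] _].
    move=> /eqP ea /eqP ee; rewrite ea ee in f1 f2 f1' f2' *; congr pair.
    by apply: (tile_eq h h'); rewrite ?f1 ?f2 ?f1' ?f2'.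
Qed.

Lemma sub_tileU r t r' t' (S : {set proc L}) :
  tile r t \subset S -> tile r' t' \subset S ->
  (tile r t :|: tile r' t')%SET \subset S.
Proof. by rewrite finset.subUset => -> ->. Qed.

Lemma send_tile_within (S : {set proc L}) r t r' t' :
  tile r t \subset S -> tile r' t' \subset S ->
  cost_within u S (2 * kappa) (send_tile M (tile r t) (tile r' t')).
Proof.
move=> h h'; apply: withinS (sub_tileU h h').
apply: between_within => // a a'; rewrite -[kappa]mulr1.
by apply: (send_within kappa0 HM) => //; rewrite mul1r.
Qed.

Lemma exchange_tile_within (S : {set proc L}) r t r' t' :
  tile r t \subset S -> tile r' t' \subset S ->
  cost_within u S (4 * kappa) (exchange_tile M (tile r t) (tile r' t')).
Proof.
move=> h h'; apply: withinS (sub_tileU h h').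
have -> : 4 * kappa = 2 * (2 * kappa * 1) by ring.
apply: between_within => [|a a']; first by rewrite !mulr_ge0.
by apply: (exchange_within kappa0 HM) => //; rewrite mul1r.
Qed.

(** Broadcasts along one direction from different positions reach disjoint sets; the row and column
    families meet, so their coefficients 4 add. *)
Lemma bcast_tile_within (I : nat) :
  cost_within u (@slab L (pred1 I) predT predT :|: slab predT (pred1 I) predT)%SET 8
    (bcast_tile (R := R) L I).
Proof.
have bc (X : {set proc L}) : cost_within u X 4 (bcast X (2 * b_ L ^ 2)).
  have -> : 4 = 2 * 2 :> R by ring.
  apply: bcast_within => //; first by rewrite ler1n.
  by rewrite natrM ler_wpM2l.
have -> : 8 = 1%:R * 4 + 1%:R * 4 :> R by ring.
apply: par_cat.
- apply: (@par_map _ _ _ u _ (fun a => [set a' in slab (pred1 I) predT (pred1 0%N)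
      | same_pos a a']%SET) 1) => // [a _|x].
    apply: fintype.subset_trans (finset.subsetUl _ _).
    apply/fintype.subsetP => y; rewrite inE => /andP[+ _].
    exact/fintype.subsetP/sub_slab.
  apply: count_le1; rewrite ?enum_uniq// => a a'.
  rewrite !mem_enum => h h'; rewrite !inE.
  move=> /andP[_ /andP[/eqP f1 /eqP f2]] /andP[_ /andP[/eqP f1' /eqP f2']].
  by apply: (tile_eq h h'); rewrite ?f1 ?f2 ?f1' ?f2'.
- apply: (@par_map _ _ _ u _ (fun a => [set a' in slab predT (pred1 I) (pred1 0%N)
      | same_pos a a']%SET) 1) => // [a _|x].
    apply: fintype.subset_trans (finset.subsetUr _ _).
    apply/fintype.subsetP => y; rewrite inE => /andP[+ _].
    exact/fintype.subsetP/sub_slab.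
  apply: count_le1; rewrite ?enum_uniq// => a a'.
  rewrite !mem_enum => h h'; rewrite !inE.
  move=> /andP[_ /andP[/eqP f1 /eqP f2]] /andP[_ /andP[/eqP f1' /eqP f2']].
  by apply: (tile_eq h h'); rewrite ?f1 ?f2 ?f1' ?f2'.
Qed.

Lemma transpose_tile_within I J :
  cost_within u (tile I J) (8 * kappa) (transpose_tile M L I J).
Proof.
have -> : 8 * kappa = 2%:R * (2 * kappa * 2) by ring.
apply: (@par_map _ _ _ u _ (fun aa => [set aa.1; aa.2]%SET) 2) => //.
- by rewrite !mulr_ge0.
- move=> aa _; apply: (exchange_within kappa0 HM) => //.
    by rewrite ler1n.
  by rewrite natrM ler_wpM2l.
- move=> [a a']; rewrite mem_filter /= => /andP[/and3P[h h' _] _].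
  exact: sub_set2.
- move=> x; apply: (@count_leD _ _ (fun aa => aa.1 == x) (fun aa => aa.2 == x)
    _ 1 1) => [[a a'] /set2P[]->||]; rewrite ?eqxx ?orbT//.
  + apply: count_le1; first by rewrite filter_uniq// enum_uniq.
    move=> [a a'] [e e']; rewrite !mem_filter /=.
    move=> /andP[/and5P[_ h /eqP f1 /eqP f2 _] _].
    move=> /andP[/and5P[_ h' /eqP f1' /eqP f2' _] _].
    move=> /eqP ea /eqP ee; rewrite ea ee in f1 f2 f1' f2' *; congr pair.
    by apply: (tile_eq h h'); rewrite -?f1 -?f2 -?f1' -?f2'.
  + apply: count_le1; first by rewrite filter_uniq// enum_uniq.
    move=> [a a'] [e e']; rewrite !mem_filter /=.
    move=> /andP[/and5P[h _ /eqP f1 /eqP f2 _] _].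
    move=> /andP[/and5P[h' _ /eqP f1' /eqP f2' _] _].
    move=> /eqP ea /eqP ee; rewrite ea ee in f1 f2 f1' f2' *; congr pair.
    by apply: (tile_eq h h'); rewrite ?f1 ?f2 ?f1' ?f2'.
Qed.

Lemma mm25_within I J : (I < q_ L)%N -> (J < q_ L)%N ->
  cost_within u (@slab L (pred1 I) (pred1 J) predT) (2 * kappa)
    (mm25_task M (@slab L (pred1 I) (pred1 J) predT) (B_ L) (c_ L)).
Proof.
move=> Iq Jq; rewrite /mm25_task (card_slab facts Iq Jq).
have pE : (mu_ L ^ 2 * c_ L)%:R = mu ^+ 2 * c by rewrite natrM natrX.
have cN0 : c != 0 by rewrite gt_eqF.
have muN0 : mu != 0 by rewrite gt_eqF.
(* The condition c <= p^(1/3) for p = mu^2 c says c^3 <= mu^2 c, which is a consequence of c <=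
   mu. *)
have h1 : (c_ L)%:R <= (mu_ L ^ 2 * c_ L)%:R `^ (3%:R^-1) :> R.
  have -> : (c_ L)%:R = (c ^+ 3) `^ (3%:R^-1).
    by rewrite -powR_mulrn// -powRrM divff// powRr1.
  apply: ge0_ler_powR; rewrite ?nnegrE ?invr_ge0 ?exprn_ge0//.
  rewrite pE exprSr ler_wpM2r//.
  by rewrite lerXn2r.
have h2 : Num.sqrt ((mu_ L ^ 2 * c_ L)%:R / (c_ L)%:R) = (mu_ L)%:R :> R.
  by rewrite pE -/c mulfK// sqrtr_sqr ger0_norm.
have h3 : (mu_ L %| B_ L)%N by rewrite dvdn_mulr.
have [/andP[_ hm] /andP[_ hw] /andP[_ hf]] := mm25P HM (gf_c facts) h1 h2 h3.
(* With p = mu^2 c and N = mu b, the bound on words becomes (mu b)^2 / (mu c) and the one on flops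
   (mu b)^3 / (mu^2 c): exactly one unit of [u] each. *)
have e1 : Num.sqrt ((mu_ L ^ 2 * c_ L)%:R / (c_ L)%:R ^+ 3) = mu / c :> R.
  have -> : (mu_ L ^ 2 * c_ L)%:R / (c_ L)%:R ^+ 3 = (mu / c) ^+ 2 :> R.
    by rewrite pE -/c; field.
  by rewrite sqrtr_sqr ger0_norm ?divr_ge0.
have e2 : Num.sqrt ((c_ L)%:R * (mu_ L ^ 2 * c_ L)%:R) = mu * c :> R.
  have -> : (c_ L)%:R * (mu_ L ^ 2 * c_ L)%:R = (mu * c) ^+ 2 :> R.
    by rewrite pE -/c; ring.
  by rewrite sqrtr_sqr ger0_norm ?mulr_ge0.
have [u1 _ uw uf] := uu.
split => //.
(* The factor 2 pays separately for mu / c <= d and for the logarithm of c. *)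
- apply: (le_trans hm); rewrite /= e1 [2 * _]mulrC -!mulrA ler_wpM2l//.
  rewrite mulr_natl mulr2n; apply: lerD.
    apply: le_trans (_ : d <= _); last first.
      by rewrite ler_peMr// (le_trans mu_ge0).
    by rewrite ler_pdivrMr// (le_trans mud)// ler_peMr// (le_trans mu_ge0).
  have lgc : log2 (c_ L)%:R <= log2 #|proc L|%:R :> R.
    rewrite /log2 ler_wpM2r ?invr_ge0 ?ln_ge0 ?ler1n//.
    rewrite ler_ln ?posrE ?ltr0n ?(ltnW (card_proc_gt1 facts))//.
      by rewrite ler_nat card_proc leq_pmull// muln_gt0 ltnW ?(gf_d facts).
    exact: gf_c.
  apply: (le_trans lgc); apply: ler_peMl; first exact: le_trans ler01 lg1.
  by rewrite (le_trans _ d2)// ler1n.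
- have e3 : (B_ L)%:R ^+ 2 / (mu * c) = words u.
    by rewrite /= natrM -/mu -/b -/c; field; rewrite muN0 cN0.
  by apply: (le_trans hw); rewrite e2 e3; have := mulr_ge0 kappa0 uw; lra.
- have e3 : (B_ L)%:R ^+ 3 / (mu ^+ 2 * c) = flops u.
    by rewrite /= natrM -/mu -/b -/c; field; rewrite muN0 cN0.
  by apply: (le_trans hf); rewrite pE e3; have := mulr_ge0 kappa0 uf; lra.
Qed.

Lemma update_tile_within I J : (I < q_ L)%N -> (J < q_ L)%N ->
  cost_within u (@slab L (pred1 I) (pred1 J) predT) (4 * kappa + 1)
    (update_tile M L I J).
Proof.
move=> Iq Jq; have hm := mm25_within Iq Jq.
have -> : 4 * kappa + 1 = 2 * kappa + (2 * kappa + (1%:R * 1 + 0)) by ring.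
do !apply: serial_cons => //; last exact: serial_nil.
apply: (@par_map _ _ _ u _ (fun a => [set a]%SET)) => //.
- by move=> a _; apply: local_within => //; rewrite mul1r.
- move=> a; rewrite mem_enum finset.sub1set.
  by apply/fintype.subsetP/sub_slab.
- move=> x; apply: count_le1; rewrite ?enum_uniq// => a a' _ _.
  by move=> /set1P <- /set1P.
Qed.

Lemma update_row_tile_within I J : (I < q_ L)%N -> (J < q_ L)%N ->
  cost_within u (@slab L (pred1 I) (pred1 J) predT) (12 * kappa + 1)
    (update_row_tile M L I J).
Proof.
move=> Iq Jq.
have -> : 12 * kappa + 1 = 8 * kappa + (4 * kappa + 1 + 0) by ring.
apply: serial_cons.
  by apply: withinS (transpose_tile_within I J) _; apply: sub_slab.
apply: serial_cons; first exact: update_tile_within.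
exact: serial_nil.
Qed.

Lemma par_tiles_of_row (S : {set proc L}) k (X : pred nat) (l : seq nat) F :
  0 <= k -> uniq l ->
  {in l, forall K, cost_within u (@slab L X (pred1 K) predT) k (F K)} ->
  slab X predT predT \subset S -> cost_within u S k (par [seq F K | K <- l]).
Proof.
move=> k0 ul hF hS; rewrite -[k]mul1r.
apply: (@par_map _ _ _ u S (fun K => slab X (pred1 K) predT) 1) => //.
  by move=> K _; apply: fintype.subset_trans hS; exact: sub_slab.
move=> x; apply: count_le1 => // K K' _ _; rewrite !mem_slab.
by move=> /and3P[_ /eqP <- _] /and3P[_ /eqP <- _].
Qed.

Lemma par_tiles_of_col (S : {set proc L}) k (X : pred nat) (l : seq nat) F :
  0 <= k -> uniq l ->
  {in l, forall K, cost_within u (@slab L (pred1 K) X predT) k (F K)} ->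
  slab predT X predT \subset S -> cost_within u S k (par [seq F K | K <- l]).
Proof.
move=> k0 ul hF hS; rewrite -[k]mul1r.
apply: (@par_map _ _ _ u S (fun K => slab (pred1 K) X predT) 1) => //.
  by move=> K _; apply: fintype.subset_trans hS; exact: sub_slab.
move=> x; apply: count_le1 => // K K' _ _; rewrite !mem_slab.
by move=> /and3P[/eqP <- _ _] /and3P[/eqP <- _ _].
Qed.

(** * Scattering a subproblem over its solver grid *)

Implicit Types (p : 'I_(q_ L) * 'I_(q_ L)) (x a : proc L).

Definition owners (p : 'I_(q_ L) * 'I_(q_ L)) : {set proc L} :=
  slab (pred2 (p.1 : nat) (p.2 : nat)) (pred2 (p.1 : nat) (p.2 : nat)) (pred1 0%N).

(* As bh <= b, a block of the grid meets at most 2 x 2 fine blocks, so that a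
   processor takes part in at most 4 scatters as a destination, and in one as a
   source. *)
Lemma scatter_count p x : (p.1 < p.2)%N ->
  (count (fun a => x \in scatter_group Pl p a) (enum (owners p)) <= 5)%N.
Proof.
move=> plt; have [Pinj _] := Pl_ok plt.
pose G a : {set proc L} := [set Pl p.1 p.2 uv.1 uv.2 | uv : 'I_(s_ L) * 'I_(s_ L) &
  overlap L (sub_row p.2 a) uv.1 && overlap L (sub_col p.2 a) uv.2]%SET.
apply: (@count_leD _ _ (pred1 x) (fun a => x \in G a) _ 1 4) => [a||].
- by rewrite /scatter_group in_setU1 /= eq_sym.
- by rewrite count_uniq_mem ?enum_uniq// leq_b1.
case: (pickP (fun uv : 'I_(s_ L) * 'I_(s_ L) => x == Pl p.1 p.2 uv.1 uv.2))
    => [[i j] /eqP ->|h]; last first.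
  rewrite (@eq_count _ _ pred0) ?count_pred0// => a /=.
  by apply/negP => /imsetP[uv _ /eqP]; rewrite h.
pose k := (i * bh_ L %/ b_ L)%N; pose l := (j * bh_ L %/ b_ L)%N.
apply: (@count_le_image _ _ _ _ (fun a => (sub_row p.2 a, sub_col p.2 a))
  [:: (k, l); (k, l.+1); (k.+1, l); (k.+1, l.+1)]); first exact: enum_uniq.
- move=> a a'; rewrite !mem_enum !mem_slab => /and3P[r1 r2 /eqP r3].
  move=> /and3P[r1' r2' /eqP r3'] _ _ [e1 e2].
  have mu_gt0 := leq_trans (gf_c facts) (gf_cmu facts).
  have [e3 e4] := sub_index_inj facts r1 r1' (ltn_pmod _ mu_gt0) (ltn_pmod _ mu_gt0) e1.
  have [e5 e6] := sub_index_inj facts r2 r2' (ltn_pmod _ mu_gt0) (ltn_pmod _ mu_gt0) e2.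
  by apply: proc_eq => //; rewrite r3.
- move=> a _ /imsetP[[i' j']]; rewrite inE /= => /andP[h1 h2] e.
  have [ei ej] : (i, j) = (i', j') by exact: Pinj.
  rewrite -ei in h1; rewrite -ej in h2.
  case/orP: (overlap_bound facts h1) => /eqP ->;
  case/orP: (overlap_bound facts h2) => /eqP ->;
  by rewrite !inE eqxx ?orbT.
Qed.

Lemma sub_scatter_group p a : (p.1 < p.2)%N -> a \in owners p ->
  scatter_group Pl p a \subset cross25d p.
Proof.
move=> plt; have [_ Pin] := Pl_ok plt; rewrite mem_slab => /and3P[h _ _].
apply/fintype.subsetP => x /setU1P[->|/imsetP[uv _ ->]].
  by rewrite mem_cross25d; case/orP: h => /eqP ->; rewrite eqxx ?orbT.
move: (Pin uv.1 uv.2); rewrite mem_slab mem_cross25d => /and3P[_ + _].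
by move=> /orP[]/eqP ->; rewrite eqxx ?orbT.
Qed.

(** * 2D sweeps measured in the unit of the 2.5D algorithm *)

Variable theta : R.
Hypotheses (theta0 : 0 < theta) (mu_theta : mu * c <= theta * d).

(** Any [K] with K^2 >= 2 theta, K^2 >= 8 theta and K >= 4 would do; these arise from the messages,
    words and flops of a 2D sweep. *)
Let K : R := 4 + 4 * theta.

Let s2 : s ^+ 2 = 2 * mu * (c * d).
Proof. by rewrite -natrX (gf_s facts) !natrM. Qed.

Let d0 : 0 < d. Proof. exact: lt_le_trans mud. Qed.

Let s0 : 0 < s.
Proof.
have : 0 < s ^+ 2 by rewrite s2 !mulr_gt0.
by rewrite lt0r sqrf_eq0 => /andP[sN0 _]; rewrite lt0r sN0 ler0n.
Qed.

Let sbh : s * bh = 2 * mu * b.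
Proof. by rewrite -natrM -(gf_bh facts) !natrM mulrA. Qed.

Lemma grid_side_le : s <= K * d.
Proof.
have K0 : 0 <= K by rewrite /K; move: theta0; lra.
rewrite -(@ler_pXn2r _ 2)// ?nnegrE ?mulr_ge0//.
rewrite s2; have -> : 2 * mu * (c * d) = 2 * (mu * c) * d by ring.
apply: le_trans (_ : 2 * (theta * d) * d <= _).
  by rewrite ler_wpM2r ?(ltW d0)// ler_wpM2l.
rewrite exprMn; have -> : 2 * (theta * d) * d = 2 * theta * d ^+ 2 by ring.
by rewrite ler_wpM2r ?exprn_ge0 ?(ltW d0)// /K; move: theta0; nra.
Qed.

(** The words of a 2D sweep decrease with s, so s must not be too small. The square of mu c is
    turned by mu c <= theta d into a multiple of mu c d, that is, of s^2. *)
Lemma grid_side_ge : 4 * (mu * c) <= K * s.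
Proof.
have K0 : 0 <= K by rewrite /K; move: theta0; lra.
rewrite -(@ler_pXn2r _ 2)// ?nnegrE ?mulr_ge0 ?mulr_ge0 ?(ltW s0)//.
apply: le_trans (_ : 16 * (mu * c) * (theta * d) <= _).
  have -> : (4 * (mu * c)) ^+ 2 = 16 * (mu * c) * (mu * c) by ring.
  by rewrite ler_wpM2l// !mulr_ge0.
have -> : 16 * (mu * c) * (theta * d) = 8 * theta * s ^+ 2 by rewrite s2; ring.
by rewrite exprMn ler_wpM2r ?sqr_ge0// /K; move: theta0; nra.
Qed.

Lemma sweep2d_words_le : s * bh ^+ 2 <= K * words u.
Proof.
have -> : s * bh ^+ 2 = 4 * (mu * c) / s * (mu * b ^+ 2 / c).
  have -> : s * bh ^+ 2 = (s * bh) ^+ 2 / s by field; rewrite gt_eqF.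
  by rewrite sbh; field; rewrite !gt_eqF.
rewrite /= -/mu -/b -/c ler_wpM2r ?divr_ge0 ?mulr_ge0 ?exprn_ge0//.
by rewrite ler_pdivrMr// grid_side_ge.
Qed.

(** Eliminating bh through s bh = 2 mu b and then s^2 leaves the factor 4 mu / d, at most 4 since mu
    <= d. *)
Lemma sweep2d_flops_le : s * bh ^+ 3 <= K * flops u.
Proof.
have -> : s * bh ^+ 3 = 4 * mu / d * (mu * b ^+ 3 / c).
  have -> : s * bh ^+ 3 = (s * bh) ^+ 3 / s ^+ 2 by field; rewrite gt_eqF.
  by rewrite sbh s2; field; rewrite !gt_eqF.
rewrite /= -/mu -/b -/c ler_wpM2r ?divr_ge0 ?mulr_ge0 ?exprn_ge0//.
by rewrite ler_pdivrMr// /K; have := mulr_gt0 theta0 d0; move: mud; lra.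
Qed.

Lemma sweep2d_within25d p : (p.1 < p.2)%N ->
  cost_within u (cross25d p) (K * (2 * (35 * kappa + 22)))
    (sweep2d M (bh_ L) (Pl p.1 p.2)).
Proof.
move=> plt; have [Pinj Pin] := Pl_ok plt.
(* The reference cost of a single group of the 2D sweep; the s groups turn it into [K] units of
   [u]. *)
pose v := Cost (log2 #|proc L|%:R) (bh ^+ 2) (bh ^+ 3).
have l0 : 0 <= log2 #|proc L|%:R :> R by exact: le_trans lg1.
have v_unit : cost_unit (proc L) v by split => //=; rewrite exprn_ge0.
have k0 : 0 <= 2 * (35 * kappa + 22) by rewrite mulr_ge0// addr_ge0// mulr_ge0.
have inX i j : Pl p.1 p.2 i j \in cross25d p.
  move: (Pin i j); rewrite mem_slab mem_cross25d => /and3P[_ + _].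
  by move=> /orP[]/eqP ->; rewrite eqxx ?orbT.
apply: (within_weaken (sweep2d_within kappa0 HM Pinj v_unit _ _ inX)) => //.
- by rewrite natrX.
- by rewrite natrX.
- have := ler_wpM2l k0 (ler_wpM2r l0 grid_side_le).
  by rewrite /= -/s -/d; set k := 2 * _; lra.
- have := ler_wpM2l k0 sweep2d_words_le.
  by rewrite [words v]/= -/s; set k := 2 * _; lra.
- have := ler_wpM2l k0 sweep2d_flops_le.
  by rewrite [flops v]/= -/s; set k := 2 * _; lra.
Qed.

(** * One subproblem and one full sweep *)

Lemma pair25d_within (k sigma : nat) p : (p.1 < p.2)%N -> (k <= sigma)%N ->
  cost_within u (cross25d p)
    (56 * kappa + 37 + sigma%:R * (K * (2 * (35 * kappa + 22))))
    (pair25d M Pl k p).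
Proof.
move=> plt ks; set Ks := K * _; set S := cross25d p.
have K0 : 0 <= Ks.
  by rewrite !mulr_ge0// ?addr_ge0// mulr_ge0// ltW.
have k2 : 0 <= 2 * kappa by rewrite mulr_ge0.
have k4 : 0 <= 4 * kappa by rewrite mulr_ge0.
have k41 : 0 <= 4 * kappa + 1 by rewrite addr_ge0.
have k12 : 0 <= 12 * kappa + 1 by rewrite addr_ge0// mulr_ge0.
have tileS I J : pred2 (p.1 : nat) (p.2 : nat) I || pred2 (p.1 : nat) (p.2 : nat) J ->
    tile I J \subset S.
  move=> h; apply/fintype.subsetP => a; rewrite mem_slab mem_cross25d.
  move=> /and3P[/eqP -> /eqP -> _]; move: h => /=.
  by rewrite ![(_ == (p.1 : nat))]eq_sym ![(_ == (p.2 : nat))]eq_sym -!orbA.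
have rowS (X : pred nat) : subpred X (pred2 (p.1 : nat) (p.2 : nat)) ->
    slab X predT predT \subset S.
  move=> h; apply/fintype.subsetP => a; rewrite mem_slab mem_cross25d.
  by move=> /and3P[/h /orP[]/eqP -> _ _]; rewrite eqxx ?orbT.
have colS (X : pred nat) : subpred X (pred2 (p.1 : nat) (p.2 : nat)) ->
    slab predT X predT \subset S.
  move=> h; apply/fintype.subsetP => a; rewrite mem_slab mem_cross25d.
  by move=> /and3P[_ /h /orP[]/eqP -> _]; rewrite eqxx ?orbT.
set all := iota 0 (q_ L).
set others := [seq J : nat <- all | (J != p.1 :> nat) && (J != p.2 :> nat)].
have allq : {in all, forall J, (J < q_ L)%N}.
  by move=> J; rewrite mem_iota.
have othersq : {in others, forall J, (J < q_ L)%N}.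
  by move=> J; rewrite mem_filter => /andP[_]; exact: allq.
have uall : uniq all by exact: iota_uniq.
have uoth : uniq others by rewrite filter_uniq.
have p1S : subpred (pred1 (p.1 : nat)) (pred2 (p.1 : nat) (p.2 : nat)).
  by move=> x /= ->.
have p2S : subpred (pred1 (p.2 : nat)) (pred2 (p.1 : nat) (p.2 : nat)).
  by move=> x /= ->; rewrite orbT.
have sc m : 1 <= m%:R :> R ->
    cost_within u S (5%:R * m%:R)
      (par [seq scatter (scatter_group Pl p a) (m * b_ L ^ 2)
           | a <- enum (owners p)]).
  move=> m1; apply: (@par_map _ _ _ u S (scatter_group Pl p) 5) => //.
  - by move=> a _; apply: scatter_within => //; rewrite natrM ler_wpM2l.
  - by move=> a; rewrite mem_enum; exact: sub_scatter_group.
  - by move=> x; exact: scatter_count.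
(* One summand per stage: scatters, each processor being in at most 5; 2D sweeps; gathers of twice
   the data; two sends; three families of exchanges; two broadcasts; two families of row updates,
   with transposition, and four of column updates. *)
apply: (@within_mono _ _ u S
  (5%:R * 1%:R + (sigma%:R * Ks + (5%:R * 2%:R + ((2 * kappa + (2 * kappa + 0)) +
   ((4 * kappa + (4 * kappa + 4 * kappa)) + ((8 + (8 + 0)) +
   ((12 * kappa + 1 + (12 * kappa + 1 + (4 * kappa + 1 + (4 * kappa + 1 +
     (4 * kappa + 1 + (4 * kappa + 1)))))) + 0)))))))) => //.
  lra.
rewrite /pair25d; apply: serial_cons.
  by rewrite -[(b_ L ^ 2)%N]mul1n; exact: sc.
apply: serial_cons.
  rewrite -(map_nseq k (fun=> sweep2d M (bh_ L) (Pl p.1 p.2)) tt).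
  apply: (@within_mono _ _ u S ((size (nseq k tt))%:R * Ks)) => //.
    by rewrite size_nseq ler_wpM2r// ler_nat.
  by apply: serial_map => _ _; exact: sweep2d_within25d.
(* [gather] and [scatter] have convertible bodies, so the bound on scatters applies; the factor 2
   accounts for both matrices. *)
apply: serial_cons; first by apply: (sc 2%N); rewrite ler1n.
apply: serial_cons.
  apply: par_cons => //; first by apply: send_tile_within; apply: tileS;
    rewrite /= eqxx ?orbT.
  apply: par_cons => //; last exact: par_nil.
  by apply: send_tile_within; apply: tileS; rewrite /= eqxx ?orbT.
apply: serial_cons.
  apply: par_cat; last apply: par_cat.
  - apply: (@par_tiles_of_row _ _ (pred2 (p.1 : nat) (p.2 : nat))) => //;
      last exact: rowS.
    by move=> J _; apply: exchange_tile_within; apply: sub_slab.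
  - apply: (@par_tiles_of_col _ _ (pred2 (p.1 : nat) (p.2 : nat))) => //;
      last exact: colS.
    by move=> J _; apply: exchange_tile_within; apply: sub_slab.
  - apply: (@par_tiles_of_col _ _ (pred2 (p.1 : nat) (p.2 : nat))) => //;
      last exact: colS.
    by move=> J _; apply: exchange_tile_within; apply: sub_slab.
apply: serial_cons.
  apply: par_cons => //.
    by apply: (withinS (bcast_tile_within _)); rewrite finset.subUset rowS// colS.
  apply: par_cons => //; last exact: par_nil.
  by apply: (withinS (bcast_tile_within _)); rewrite finset.subUset rowS// colS.
apply: serial_cons; last exact: serial_nil.
do !apply: par_cat.
- apply: (@par_tiles_of_row _ _ (pred1 (p.1 : nat))) => // [J /othersq Jq|].
    exact: update_row_tile_within.
  exact: rowS.
- apply: (@par_tiles_of_row _ _ (pred1 (p.2 : nat))) => // [J /othersq Jq|].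
    exact: update_row_tile_within.
  exact: rowS.
- apply: (@par_tiles_of_col _ _ (pred1 (p.1 : nat))) => // [J /othersq Jq|].
    exact: update_tile_within.
  exact: colS.
- apply: (@par_tiles_of_col _ _ (pred1 (p.2 : nat))) => // [J /othersq Jq|].
    exact: update_tile_within.
  exact: colS.
- apply: (@par_tiles_of_col _ _ (pred1 (p.1 : nat))) => // [J /allq Jq|].
    exact: update_tile_within.
  exact: colS.
- apply: (@par_tiles_of_col _ _ (pred1 (p.2 : nat))) => // [J /allq Jq|].
    exact: update_tile_within.
  exact: colS.
Qed.

Lemma sweep25d_within sigma (eig : forall k, 'M[R]_k -> 'M[R]_k * 'M[R]_k)
    (conv : forall k, 'M[R]_k -> bool) maxit (A : 'M[R]_(n_ L)) t :
  (forall (G : nat) p, (G < q_ L)%N -> p \in antidiag (q_ L) G ->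
    (inner_sweeps eig conv maxit A t G p <= sigma)%N) ->
  cost_within u [set: proc L]%SET
    ((q_ L)%:R * (2 * (56 * kappa + 37 +
       sigma%:R * (K * (2 * (35 * kappa + 22))))))
    (sweep25d M Pl eig conv maxit A t).
Proof.
move=> hsig; rewrite -[X in X%:R * _](size_iota 0).
apply: serial_map => G; rewrite mem_iota => /andP[_ Gq].
apply: (@par_map _ _ _ u _ cross25d 2) => //.
- by rewrite !(addr_ge0, mulr_ge0)// ltW.
- move=> p hp; apply: pair25d_within; last exact: hsig.
  by move: hp; rewrite mem_filter => /andP[/andP[]].
- exact: cross25d_count.
Qed.

End Sweep25DCost.

(** * From grid dimensions to the stated bounds *)

Lemma log2_card_proc (R : realType) (L : layout) : grid_facts L ->
  log2 #|proc L|%:R <= 3 / (2 * ln 2) * ln ((d_ L)%:R ^+ 2) :> R.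
Proof.
move=> facts; have d0 : (0 < d_ L)%N := ltnW (gf_d facts).
have ln2 : 0 < ln 2 :> R by rewrite ln_gt0// ltr1n.
rewrite lnXn ?ltr0n// /log2 ler_pdivrMr//.
have -> : 3 / (2 * ln 2) * (ln (d_ L)%:R *+ 2) * ln 2 = ln (d_ L)%:R *+ 3 :> R.
  by field; rewrite gt_eqF.
(* As c <= mu <= d, the c d^2 processors are at most d^3, and 3 ln d is 3/2 of ln (d^2), where d^2 =
   P/c. *)
rewrite -lnXn ?ltr0n// -natrX ler_ln ?posrE ?ltr0n ?expn_gt0 ?d0//.
  rewrite ler_nat card_proc !expnS expn0 muln1 -mulnA !leq_mul//.
  exact: leq_trans (gf_cmu facts) (gf_mud facts).
by rewrite card_proc !muln_gt0 d0 (gf_c facts).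
Qed.

Theorem corollary1 (R : realType) (kappa theta1 theta2 : R) (sigma : nat)
    (kappa_gt0 : 0 < kappa) (theta1_gt0 : 0 < theta1) (theta2_gt0 : 0 < theta2) :
  exists2 C : R, 0 < C &
  forall (M : machine R) (P : nat) (L : layout) (eta : R) (Pl : placement L)
    (eig : forall k : nat, 'M[R]_k -> 'M[R]_k * 'M[R]_k)
    (conv : forall k : nat, 'M[R]_k -> bool) (maxit : nat)
    (A : 'M[R]_(n_ L)) (t : nat),
  machine_bounds kappa M ->
  admissible P eta L ->
  theta1 * Num.sqrt (P%:R / (c_ L)%:R ^+ 3) <= (mu_ L)%:R
    <= theta2 * Num.sqrt (P%:R / (c_ L)%:R ^+ 3) ->
  eta = 1 ->
  placement_ok Pl ->
  eig_spec eig ->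
  A^T = A ->
  (forall (K : nat) (p : 'I_(q_ L) * 'I_(q_ L)),
     (K < q_ L)%N -> p \in antidiag (q_ L) K ->
     (inner_sweeps eig conv maxit A t K p <= sigma)%N) ->
  let T := tcost (sweep25d M Pl eig conv maxit A t) in
  [/\ msgs T <= C * (Num.sqrt ((c_ L)%:R * P%:R) * ln (P%:R / (c_ L)%:R)),
      words T <= C * ((n_ L)%:R ^+ 2 / Num.sqrt ((c_ L)%:R * P%:R))
    & flops T <= C * ((n_ L)%:R ^+ 3 / P%:R)].
Proof.
pose Kp := 2 * (56 * kappa + 37 +
  sigma%:R * ((4 + 4 * theta2) * (2 * (35 * kappa + 22)))).
have Kp0 : 0 < Kp.
  rewrite mulr_gt0// ltr_wpDr//; last by rewrite addr_gt0// mulr_gt0.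
  by rewrite !(addr_ge0, mulr_ge0)// ltW.
have ln2 : 0 < ln 2 :> R by rewrite ln_gt0// ltr1n.
(* The constant of the message bound: comparison of log P with ln (P/c), times the factor 1 / theta1
   of the number of groups. In [1 + C1] the 1 covers words and flops. *)
pose C1 := 3 / (2 * ln 2) / theta1.
have C1_ge0 : 0 <= C1 by rewrite !divr_ge0// ?mulr_ge0// ltW.
exists (Kp * (1 + C1)); first by rewrite mulr_gt0// ltr_wpDr.
move=> M P L eta Pl eig conv maxit A t HM adm hmu eta1 Pl_ok _ _ hsig T.
have facts := admissible_facts adm eta1.
move: hmu; rewrite (admissible_sqrt_Pc3 adm) => /andP[hmu1 hmu2].
rewrite (admissible_sqrt_cP adm) (admissible_P adm) (adm_b adm) natrM.
have c0 : 0 < (c_ L)%:R :> R by rewrite ltr0n (gf_c facts).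
have d0 : 0 < (d_ L)%:R :> R by rewrite ltr0n ltnW// (gf_d facts).
have b0 : 0 < (b_ L)%:R :> R by rewrite ltr0n (gf_b facts).
have mu0 : 0 < (mu_ L)%:R :> R.
  by rewrite ltr0n (leq_trans (gf_c facts) (gf_cmu facts)).
have dq : (d_ L)%:R = (q_ L)%:R * (mu_ L)%:R :> R by rewrite -natrM -(gf_q facts).
have mu_theta : (mu_ L)%:R * (c_ L)%:R <= theta2 * (d_ L)%:R :> R.
  by rewrite -ler_pdivlMr// -mulrA.
(* The lower bound on mu limits the number of groups, q = d / mu. *)
have q_le : (q_ L)%:R <= (c_ L)%:R / theta1 :> R.
  rewrite ler_pdivlMr// -(ler_pM2r mu0) mulrAC -dq.
  by rewrite [leLHS]mulrC [leRHS]mulrC -ler_pdivrMr// -mulrA.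
have [_ hm hw hf] := sweep25d_within (ltW kappa_gt0) HM facts Pl_ok
  theta2_gt0 mu_theta hsig.
rewrite -/T -/Kp in hm hw hf.
have KpC : Kp <= Kp * (1 + C1) by rewrite ler_peMr ?(ltW Kp0)// lerDl.
split.
- apply: (le_trans hm) => /=.
  have -> : (c_ L)%:R * (d_ L)%:R ^+ 2 / (c_ L)%:R = (d_ L)%:R ^+ 2 :> R.
    by field; rewrite gt_eqF.
  set X := ln _.
  have X0 : 0 <= X.
    by rewrite ln_ge0// -natrX ler1n expn_gt0 ltnW// (gf_d facts).
  have lg0 : 0 <= log2 #|proc L|%:R :> R.
    by apply: (le_trans ler01); exact/log2_ge1/card_proc_gt1.
  have h := ler_pM (ler0n _ _) lg0 q_le (log2_card_proc R facts).
  rewrite -/X in h.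
  have e : (c_ L)%:R / theta1 * (3 / (2 * ln 2) * X) = C1 * (c_ L)%:R * X.
    by rewrite /C1; field; rewrite !gt_eqF.
  rewrite e in h.
  have h1 := ler_wpM2l (mulr_ge0 (ltW Kp0) (ltW d0)) h.
  have h2 : 0 <= Kp * ((c_ L)%:R * (d_ L)%:R * X).
    by rewrite mulr_ge0 ?(ltW Kp0)// !mulr_ge0.
  set lg := log2 _ in h1 *.
  rewrite [leLHS](_ : _ = Kp * (d_ L)%:R * ((q_ L)%:R * lg)); last by ring.
  apply: (le_trans h1).
  rewrite [leRHS](_ : _ = Kp * (d_ L)%:R * (C1 * (c_ L)%:R * X) +
    Kp * ((c_ L)%:R * (d_ L)%:R * X)); last by ring.
  by rewrite lerDl.
- apply: (le_trans hw) => /=.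
  (* The number of groups cancels against the factor mu of the unit, through q mu = d. *)
  have -> : (q_ L)%:R * Kp * ((mu_ L)%:R * (b_ L)%:R ^+ 2 / (c_ L)%:R) =
      Kp * (((d_ L)%:R * (b_ L)%:R) ^+ 2 / ((c_ L)%:R * (d_ L)%:R)) :> R.
    rewrite [RHS](_ : _ = Kp * ((d_ L)%:R * (b_ L)%:R ^+ 2 / (c_ L)%:R)); last first.
      by field; rewrite !gt_eqF.
    by rewrite dq; ring.
  by rewrite ler_wpM2r// divr_ge0 ?exprn_ge0 ?mulr_ge0.
- apply: (le_trans hf) => /=.
  have -> : (q_ L)%:R * Kp * ((mu_ L)%:R * (b_ L)%:R ^+ 3 / (c_ L)%:R) =
      Kp * (((d_ L)%:R * (b_ L)%:R) ^+ 3 / ((c_ L)%:R * (d_ L)%:R ^+ 2)) :> R.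
    rewrite [RHS](_ : _ = Kp * ((d_ L)%:R * (b_ L)%:R ^+ 3 / (c_ L)%:R)); last first.
      by field; rewrite !gt_eqF.
    by rewrite dq; ring.
  by rewrite ler_wpM2r// divr_ge0 ?exprn_ge0 ?mulr_ge0 ?exprn_ge0.
Qed.
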